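(* Let $f\colon Y\to X$ be a finite surjective morphism of normal varieties over an $F$-finite field $k$ of characteristic $p>0$, and let $n\geq 1$. Let $\Delta$ and $\Delta_Y$ be effective $\mathbb{Q}$-divisors on $X$ and $Y$, respectively, such that $\lfloor\Delta\rfloor=\lfloor\Delta_Y\rfloor=0$ and the linear equivalence $f^*(K_X+\Delta)\sim K_Y+\Delta_Y$ holds. Suppose that the degree of $f$ is not divisible by $p$. In this case, if $(Y,\Delta_Y)$ is $n$-quasi-$F$-split, then so is $(X,\Delta)$.
   Context: Linear equivalence $D\sim D'$ of $\mathbb{Q}$-divisors means that $D-D'$ is the divisor of a nonzero rational function. The degree of $f$ is the degree of the extension of function fields. Quasi-$F$-splitting of pairs: let $X$ be an integral normal $F$-finite Noetherian $\mathbb{F}_p$-scheme with function field $K(X)$. For a $\mathbb{Q}$-divisor $D$ put $\mathcal{O}_X(D)=\mathcal{O}_X(\lfloor D\rfloor)$, and let $W_n\mathcal{O}_X(D)$ be the subsheaf of the constant sheaf $W_n(K(X))$ whose sections over $U$ are the Witt vectors $(\varphi_0,\dots,\varphi_{n-1})$ with $\varphi_i\in\Gamma(U,\mathcal{O}_X(p^iD))$ for all $i$; it is a $W_n\mathcal{O}_X$-module. There are a Frobenius $F\colon W_n\mathcal{O}_X(D)\to F_*W_n\mathcal{O}_X(pD)$ (componentwise $p$-th power) and a restriction $R^{n-1}\colon W_n\mathcal{O}_X(D)\to\mathcal{O}_X(D)$ (first component). If $\lfloor\Delta\rfloor=0$, then $(X,\Delta)$ is $n$-quasi-$F$-split if there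 is a $W_n\mathcal{O}_X$-module homomorphism $\alpha\colon F_*W_n\mathcal{O}_X(p\Delta)\to\mathcal{O}_X$ such that $\alpha\circ F=R^{n-1}\colon W_n\mathcal{O}_X(\Delta)\to\mathcal{O}_X(\Delta)=\mathcal{O}_X$. *)

(* Defs.v *)
From HB Require Import structures.
From mathcomp Require Import all_boot all_order all_algebra.
From mathcomp Require Import boolp classical_sets cardinality topology.
From mathcomp Require Import mpoly.

Set Implicit Arguments.
Unset Strict Implicit.
Unset Printing Implicit Defensive.

Import Order.TTheory GRing.Theory Num.Theory.
Local Open Scope classical_set_scope.
Local Open Scope ring_scope.

Definition ghost (p n : nat) (R : nzRingType) (x : 'I_n -> R) (i : 'I_n) : R :=
  \sum_(j < n | (j <= i)%N) (p ^ j)%N%:R * x j ^+ (p ^ (i - j)).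

(* Integral polynomials in the variables X_0 .. X_(n-1) (left half) and
   Y_0 .. Y_(n-1) (right half) whose ghost components are obtained by applying
   [op] to the ghost components of X and Y.  For [op] the sum or the product,
   Witt's theorem says that there is exactly one such family when p is prime. *)
Definition witt_polys (p n : nat) (op : {mpoly int[n + n]} -> {mpoly int[n + n]} ->
    {mpoly int[n + n]}) (S : n.-tuple {mpoly int[n + n]}) : Prop :=
  forall i : 'I_n,
    ghost p (tnth S) i =
    op (ghost p (fun l => 'X_(lshift n l)) i) (ghost p (fun l => 'X_(rshift n l)) i).

Definition witt_op (p n : nat) (op : {mpoly int[n + n]} -> {mpoly int[n + n]} ->
    {mpoly int[n + n]}) (K : fieldType) (a b : n.-tuple K) : n.-tuple K :=
  let S := xget [tuple 0 | _ < n] [set S | witt_polys p op S] in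
  let ab (l : 'I_(n + n)) :=
    match split l with inl u => tnth a u | inr u => tnth b u end in
  [tuple mmap intr ab (tnth S i) | i < n].

Definition witt_add (p n : nat) (K : fieldType) (a b : n.-tuple K) : n.-tuple K :=
  witt_op p +%R a b.

Definition witt_mul (p n : nat) (K : fieldType) (a b : n.-tuple K) : n.-tuple K :=
  witt_op p *%R a b.

Definition witt_frob (p n : nat) (K : fieldType) (a : n.-tuple K) : n.-tuple K :=
  [tuple tnth a i ^+ p | i < n].

Definition subring (K : fieldType) (A : set K) : Prop :=
  [/\ A 1, forall a b, A a -> A b -> A (a - b)
    & forall a b, A a -> A b -> A (a * b)].

Definition unit_of (K : fieldType) (A : set K) (s : K) : Prop :=
  [/\ s != 0, A s & A s^-1].

Definition prime_ideal (K : fieldType) (A P : set K) : Prop :=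
  [/\ P `<=` A,
      P 0 /\ (forall a b, P a -> P b -> P (a + b)),
      forall a b, A a -> P b -> P (a * b),
      ~ P 1
    & forall a b, A a -> A b -> P (a * b) -> P a \/ P b].

Definition integrally_closed (K : fieldType) (A : set K) : Prop :=
  forall z : K,
    (exists q : {poly K}, [/\ q \is monic, forall i, A q`_i & root q z]) -> A z.

(* [k : k^p] is finite *)
Definition F_finite_field (p : nat) (k : fieldType) : Prop :=
  exists m (b : 'I_m -> k), forall x : k,
    exists c : 'I_m -> k, x = \sum_(i < m) c i ^+ p * b i.

Definition field_degree (K L : fieldType) (phi : {rmorphism K -> L}) (d : nat) : Prop :=
  exists b : 'I_d -> L, forall y : L,
    exists! c : {ffun 'I_d -> K}, y = \sum_(i < d) phi (c i) * b i.

(* The structure sheaf of an integral scheme is a subsheaf of the constant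
   sheaf of rational functions; [sections U] is the resulting subset of the
   function field.  Its value is meaningful only for nonempty open [U] (over
   the empty set a sheaf vanishes, so nothing is lost). *)

Record ratspace (k : fieldType) := RatSpace {
  points :> topologicalType;
  funfield : fieldType;
  scalars : {rmorphism k -> funfield};
  sections : set points -> set funfield
}.

Section Schemes.
Variables (k : fieldType) (X : ratspace k).
Local Notation K := (funfield X).
Local Notation O := (@sections k X).

Definition nonempty_open (U : set X) : Prop := open U /\ U !=set0.

Definition subalgebra (A : set K) : Prop :=
  subring A /\ (forall c : k, A (scalars X c)).

Definition stalk (x : X) : set K := \bigcup_(U in [set U | open U /\ U x]) O U.

Definition max_ideal (x : X) : set K := [set s | stalk x s /\ ~ unit_of (stalk x) s].

(* [U] with the restricted sheaf is Spec of [O U]: the map sending x to the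
   prime ideal of functions vanishing at x is a homeomorphism for the Zariski
   topology, and the sections over D(s) are the localisation (O U)_s. *)
Definition affine_open (U : set X) : Prop :=
  [/\ nonempty_open U,
      forall x, U x -> prime_ideal (O U) (O U `&` max_ideal x),
      forall P, prime_ideal (O U) P ->
        exists! x, U x /\ O U `&` max_ideal x = P,
      forall V, V `<=` U ->
        (open V <-> exists2 S, S `<=` O U &
           V = [set x | U x /\ exists2 s, S s & ~ max_ideal x s])
    & forall s, O U s -> s != 0 ->
        O (U `&` [set x | ~ max_ideal x s]) =
        [set z | exists a m, O U a /\ z = a / s ^+ m]].

Definition integral_scheme : Prop :=
  [/\ [set: X] !=set0 /\
      (forall U V : set X, nonempty_open U -> nonempty_open V -> U `&` V !=set0),
      forall U, nonempty_open U -> subalgebra (O U),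
      forall C : set (set X), C !=set0 -> C `<=` nonempty_open ->
        O (\bigcup_(V in C) V) = \bigcap_(V in C) O V,
      forall x, exists2 U, affine_open U & U x
    & \bigcup_(U in nonempty_open) O U = [set: K]].

Definition finite_type : Prop :=
  exists C : set (set X),
    [/\ finite_set C, \bigcup_(U in C) U = [set: X]
      & forall U, C U -> affine_open U /\
          exists g : seq K, O U = smallest subalgebra [set a | a \in g]].

(* For affine opens U and V the intersection is affine and the map from the
   tensor product of [O U] and [O V] to the sections over it is onto. *)
Definition separated : Prop :=
  forall U V, affine_open U -> affine_open V ->
    affine_open (U `&` V) /\ O (U `&` V) = smallest subalgebra (O U `|` O V).

Definition variety : Prop := [/\ integral_scheme, finite_type & separated].

Definition normal_variety : Prop :=
  variety /\ (forall x, integrally_closed (stalk x)).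

(* x is the generic point of a prime divisor *)
Definition codim1 (x : X) : Prop :=
  closure [set x] <> [set: X] /\
  forall y : X, closure [set y] x -> y = x \/ closure [set y] = [set: X].

Definition uniformizer (x : X) (t : K) : Prop :=
  max_ideal x t /\ forall s, max_ideal x s -> exists2 a, stalk x a & s = a * t.

Definition ord (x : X) (phi : K) : int :=
  xget 0 [set m : int | exists t u,
    [/\ uniformizer x t, unit_of (stalk x) u & phi = u * t ^ m]].

(* A Q-divisor is given by its coefficients at the generic points of prime
   divisors, extended by 0 to the other points of X. *)
Definition Qdivisor (D : X -> rat) : Prop :=
  (forall x, D x != 0 -> codim1 x) /\ finite_set [set x | D x != 0].

Definition effective (D : X -> rat) : Prop := forall x, 0 <= D x.

Definition round_down (D : X -> rat) : X -> int := fun x => Num.floor (D x).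

Definition lin_equiv (D D' : X -> rat) : Prop :=
  exists2 phi : K, phi != 0 & forall x, codim1 x -> D x - D' x = (ord x phi)%:~R.

(* sections over U of O_X(D) *)
Definition sheaf_of (D : X -> rat) (U : set X) : set K :=
  [set phi | phi = 0 \/ forall x, U x -> codim1 x -> 0 <= ord x phi + round_down D x].

Definition derivation (V : lmodType K) (delta : K -> V) : Prop :=
  (forall a b, delta (a + b) = delta a + delta b) /\
  (forall a b, delta (a * b) = a *: delta b + b *: delta a).

(* d identifies the absolute Kaehler differentials of K with K^r *)
Definition universal_derivation (r : nat) (d : K -> 'rV[K]_r) : Prop :=
  derivation d /\
  forall (V : lmodType K) (delta : K -> V), derivation delta ->
    exists! c : {ffun 'I_r -> V}, forall a, delta a = \sum_j d a 0 j *: c j.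

(* The divisor of the rational section e_1 /\ .. /\ e_r of the canonical sheaf
   omega_X, for a basis e_1, .., e_r of the differentials of K.

   For a normal variety over an F-finite field, omega_X is the reflexive hull
   of the top exterior power of the sheaf of ABSOLUTE differentials Omega_X.
   When k is perfect, dk = 0 and these are the differentials over k.  When k is
   imperfect, X need not be smooth over k in codimension 1 and the top exterior
   power of Omega_(X/k) is not the dualizing sheaf; but at a regular point
   Omega_X is still free, of rank r = dim X + log_p [k : k^p], and the
   determinant of the triangle L_k (x) O_X -> L_X -> L_(X/k) of cotangent
   complexes gives det Omega_X = omega_X (x)_k det Omega_k, where det Omega_k
   is a 1-dimensional vector space over k.

   At a point x of codimension 1 the module /\^r Omega_(X,x) is generated by
   the da_1 /\ .. /\ da_r = det (da_1, .., da_r) e_1 /\ .. /\ e_r with all a_i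
   in the local ring, so it is t^m O_(X,x) e_1 /\ .. /\ e_r where m is the
   least order of such a determinant, and e_1 /\ .. /\ e_r has order - m. *)
Definition canonical_divisor (D : X -> rat) : Prop :=
  Qdivisor D /\
  exists r (d : K -> 'rV[K]_r), universal_derivation d /\
    forall x, codim1 x ->
      let det_d (a : 'I_r -> K) := \det (\matrix_(i, j) d (a i) 0 j) in
      exists m : int,
        [/\ D x = - m%:~R,
            forall a, (forall i, stalk x (a i)) -> det_d a != 0 -> m <= ord x (det_d a)
          & exists a, [/\ forall i, stalk x (a i), det_d a != 0 & ord x (det_d a) = m]].

(* sections over U of W_n O_X(D) *)
Definition witt_sheaf_of (p n : nat) (D : X -> rat) (U : set X) : set (n.-tuple K) :=
  [set v | forall i : 'I_n,
     sheaf_of (fun x => (p ^ i)%N%:R * D x) U (tnth v i)].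

(* sections over U of W_n O_X *)
Definition witt_structure_sheaf (n : nat) (U : set X) : set (n.-tuple K) :=
  [set v | forall i : 'I_n, O U (tnth v i)].

(* [alpha U] is the component over U of a map F_* W_n O_X(p Delta) -> O_X;
   only its values on sections over nonempty open sets matter.  A section [r]
   of W_n O_X acts on the source through its Frobenius and on the target
   through its first component [r`_0]. *)
Definition quasi_F_split (p n : nat) (Delta : X -> rat) : Prop :=
  let pDelta := fun x => p%:R * Delta x in
  let W := @witt_sheaf_of p n in
  exists alpha : set X -> n.-tuple K -> K,
    [/\ forall U v, nonempty_open U -> W pDelta U v -> O U (alpha U v),
        forall U V v, nonempty_open U -> nonempty_open V -> V `<=` U ->
          W pDelta U v -> alpha V v = alpha U v,
        forall U v w, nonempty_open U -> W pDelta U v -> W pDelta U w ->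
          alpha U (witt_add p v w) = alpha U v + alpha U w,
        forall U (r v : n.-tuple K), nonempty_open U ->
          witt_structure_sheaf U r -> W pDelta U v ->
          alpha U (witt_mul p (witt_frob p r) v) = r`_0 * alpha U v
      & forall U (v : n.-tuple K), nonempty_open U -> W Delta U v ->
          alpha U (witt_frob p v) = v`_0].

End Schemes.

Section Morphisms.
Variables (k : fieldType) (Y X : ratspace k).
Variables (f : Y -> X) (phi : {rmorphism funfield X -> funfield Y}).

(* f together with the maps O_X(U) -> O_Y(f^-1 U) induced by phi is a
   surjective morphism of k-schemes. *)
Definition surjective_morphism : Prop :=
  [/\ continuous f,
      range f = [set: X],
      forall c, phi (scalars X c) = scalars Y c,
      forall U, nonempty_open U -> forall s, sections U s ->
        sections (f @^-1` U) (phi s)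
    & forall (y : Y) s, stalk (f y) s -> (max_ideal y (phi s) <-> max_ideal (f y) s)].

Definition finite_morphism : Prop :=
  forall U : set X, affine_open U ->
    affine_open (f @^-1` U) /\
    exists m (b : 'I_m -> funfield Y),
      (forall i, sections (f @^-1` U) (b i)) /\
      (forall z, sections (f @^-1` U) z ->
         exists c : 'I_m -> funfield X,
           (forall i, sections U (c i)) /\ z = \sum_(i < m) phi (c i) * b i).

(* order along y of the pullback of a local equation of the prime divisor f y *)
Definition ramification_index (y : Y) : int :=
  xget 0 [set m : int | exists2 t, uniformizer (f y) t & m = ord y (phi t)].

Definition pullback (D : X -> rat) : Y -> rat :=
  fun y => (ramification_index y)%:~R * D (f y).

End Morphisms.

(* Main.v *)
Require Import Defs.
From HB Require Import structures.
From mathcomp Require Import all_boot all_order all_algebra.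
From mathcomp Require Import boolp classical_sets topology.
From mathcomp Require Import mpoly ring zify lra.

(* Let [beta] be the extension of the given splitting to all Witt vectors over
   [K(Y)]: every such vector is regular over some nonempty open set.  The
   splitting of [(X, Delta)] is [v |-> d^-1 Tr (beta (phi v))], and what has to
   be shown is that it sends sections of [W_n O_X(p Delta)] to regular
   functions.  By algebraic Hartogs this may be tested at a point [x] of
   codimension 1.

   Since [KX] and [KY] have integral coefficients, the linear equivalence makes
   [e Delta(x) - DeltaY(y)] an integer for every [y] over [x] with ramification
   index [e]; it is less than [e] because [Delta < 1] and [DeltaY >= 0].  This
   is all that is needed of the canonical divisors.  Multiplying by the
   Teichmuller lift of [s^p], where [s] is the power [e - 1] of a uniformizer at
   [y], moves [phi v] into [W_n O_Y(p DeltaY)] near [y], so [beta (phi v)] has a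
   pole of order at most [e - 1] at [y].  Finally, the trace maps functions with
   such poles into the local ring of [x]; in characteristic [p] this follows
   from [Tr (z^p) = (Tr z)^p]. *)

Set Implicit Arguments.
Unset Strict Implicit.
Unset Printing Implicit Defensive.

Import Order.TTheory GRing.Theory Num.Theory.
Local Open Scope classical_set_scope.
Local Open Scope ring_scope.

(** * Subrings, ideals and noetherian rings inside a field *)

(** That [p] does not divide the degree makes [Tr 1 = d] invertible, but it does not exclude wild
    ramification at some point over [x]. What helps is that the poles have order less than [e]: if
    [t] is a uniformizer at [x], then [phi t] times such a function vanishes at every point over
    [x]. Its trace then lies in the maximal ideal [(t)] of [x], and [t] can be cancelled by
    linearity. That vanishing on the fibre passes to the trace is seen without computing a
    different: traces of a finite algebra have bounded denominators, and compatibility with [p]-th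
    powers turns a bound for high powers into one for the trace itself.

    The Teichmuller lift of [s^p] is the Frobenius of the lift of [s], so linearity over Witt
    vectors takes it out of [beta] as the factor [s]. On component [i] it acts as [s^(p^(i+1))], of
    order [p^(i+1) (e - 1)] at [y]; [p^(i+1)] is also the factor with which the divisors enter that
    component. *)

Section Subrings.
Variables (K : fieldType) (A : set K).
Hypothesis hA : subring A.

Lemma subring1 : A 1. Proof. by case: hA. Qed.

Lemma subringB a b : A a -> A b -> A (a - b).
Proof. by case: hA => _ h _; apply: h. Qed.

Lemma subringM a b : A a -> A b -> A (a * b).
Proof. by case: hA => _ _; apply. Qed.

Lemma subring0 : A 0.
Proof. by rewrite -(subrr 1); apply: subringB; apply: subring1. Qed.

Lemma subringN a : A a -> A (- a).
Proof. by rewrite -sub0r; apply: subringB; apply: subring0. Qed.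

Lemma subringD a b : A a -> A b -> A (a + b).
Proof. by move=> Aa Ab; rewrite -[b]opprK; apply: subringB => //; apply: subringN. Qed.

Lemma subringX a m : A a -> A (a ^+ m).
Proof.
move=> Aa; elim: m => [|m IH]; first by rewrite expr0; apply: subring1.
by rewrite exprS; apply: subringM.
Qed.

Definition subring_mem : {pred K} := fun z => `[< A z >].

Lemma subring_memP z : reflect (A z) (z \in subring_mem).
Proof. exact: asboolP. Qed.

Lemma subring_mem_closed : subring_closed subring_mem.
Proof.
split; first by apply/subring_memP/subring1.
- by move=> a b /subring_memP Aa /subring_memP Ab; apply/subring_memP/subringB.
- by move=> a b /subring_memP Aa /subring_memP Ab; apply/subring_memP/subringM.
Qed.

End Subrings.

(* A subring packed with its closure proof, so that the [rpred] lemmas and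
   [polyOver] apply to it. *)
Record subring_of (K : fieldType) := SubringOf {
  carrier : set K; carrier_subring : subring carrier }.

Definition mem_subring (K : fieldType) (S : subring_of K) : {pred K} :=
  subring_mem (carrier S).

HB.instance Definition _ (K : fieldType) (S : subring_of K) :=
  GRing.isSubringClosed.Build K (mem_subring S)
    (subring_mem_closed (carrier_subring S)).

Lemma char_poly_subring (K : fieldType) (A : set K) (m : nat) (M : 'M[K]_m) :
  subring A -> (forall i j, A (M i j)) -> forall i, A (char_poly M)`_i.
Proof.
move=> hA hM i; pose S := SubringOf hA.
have SP z : reflect (A z) (z \in mem_subring S) by apply: subring_memP.
suff: char_poly M \is a polyOver (mem_subring S) by move/polyOverP => /(_ i)/SP.
rewrite /char_poly /determinant; apply: rpred_sum => s _.
apply: rpredM; first exact: rpred_sign.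
apply: rpred_prod => j _; rewrite !mxE.
apply: rpredB; last by rewrite polyOverC; apply/SP.
by apply: rpredMn; apply: polyOverX.
Qed.

(** The vector [b] is a nonzero eigenvector, with eigenvalue [z], of a matrix coming from [A]; the
    characteristic polynomial is the required relation. *)
Lemma det_trick (K L : fieldType) (phi : {rmorphism K -> L}) (A : set K)
    (m : nat) (b : 'I_m -> L) (c : 'I_m -> 'I_m -> K) (z : L) :
  subring A -> (exists i, b i != 0) -> (forall i j, A (c i j)) ->
  (forall i, z * b i = \sum_j phi (c i j) * b j) ->
  exists q : {poly K}, [/\ q \is monic, forall i, A q`_i & root (map_poly phi q) z].
Proof.
move=> hA [i0 bi0] hc hz.
(* Transposed, because [eigenvalue] refers to row vectors. *)
pose M := (\matrix_(i, j) c j i)%R.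
exists (char_poly M); split; first exact: char_poly_monic.
  by apply: char_poly_subring => // i j; rewrite mxE.
rewrite map_char_poly -eigenvalue_root_char.
apply/eigenvalueP; exists (\row_i b i); last first.
  by apply/eqP => /rowP/(_ i0); rewrite !mxE => h; rewrite h eqxx in bi0.
apply/rowP => i; rewrite !mxE hz; apply: eq_bigr => j _.
by rewrite !mxE mulrC.
Qed.

Definition ideal (K : fieldType) (A I : set K) : Prop :=
  [/\ I `<=` A, I 0, forall a b, I a -> I b -> I (a + b)
    & forall a b, A a -> I b -> I (a * b)].

(** Generation is expressed by minimality among ideals; [noetherian_sums] recovers linear
    combinations. *)
Definition noetherian (K : fieldType) (A : set K) : Prop :=
  forall I, ideal A I -> exists g : seq K, (forall a, a \in g -> I a) /\
    forall J, ideal A J -> (forall a, a \in g -> J a) -> I `<=` J.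

Section Ideals.
Variables (K : fieldType) (A : set K).
Hypothesis hA : subring A.

Lemma idealN I a : ideal A I -> I a -> I (- a).
Proof.
case=> _ _ _ IM Ia; rewrite -mulN1r; apply: IM => //.
by apply: subringN => //; apply: subring1.
Qed.

Lemma idealB I a b : ideal A I -> I a -> I b -> I (a - b).
Proof. by move=> hI; case: (hI) => _ _ ID _ Ia Ib; apply: ID => //; apply: idealN. Qed.

Lemma idealI I J : ideal A I -> ideal A J -> ideal A (I `&` J).
Proof.
move=> [IA I0 ID IM] [JA J0 JD JM]; split.
- by move=> a [/IA].
- by [].
- by move=> a b [Ia Ja] [Ib Jb]; split; [apply: ID|apply: JD].
- by move=> a b Aa [Ib Jb]; split; [apply: IM|apply: JM].
Qed.

Lemma ideal_denominators z : ideal A [set s | A s /\ A (s * z)].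
Proof.
split.
- by move=> s [].
- by rewrite /= mul0r; split; apply: subring0.
- by move=> a b [Aa Az] [Ab Bz]; split; rewrite ?mulrDl; apply: subringD.
- by move=> a b Aa [Ab Bz]; split; rewrite -?mulrA; apply: subringM.
Qed.

Lemma ideal_gen_sums (g : seq K) : (forall a, a \in g -> A a) ->
  ideal A [set z | exists c : 'I_(size g) -> K,
     (forall i, A (c i)) /\ z = \sum_i c i * g`_i].
Proof.
move=> gA; split.
- move=> _ [c [Ac ->]]; elim/big_ind: _ => //; first exact: subring0.
    by move=> a b; apply: subringD.
  by move=> i _; apply: subringM => //; apply: gA; rewrite mem_nth.
- exists (fun _ => 0); split; first by move=> _; apply: subring0.
  by rewrite big1 // => i _; rewrite mul0r.
- move=> _ _ [c [Ac ->]] [c' [Ac' ->]]; exists (fun i => c i + c' i); split.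
    by move=> i; apply: subringD.
  by rewrite -big_split; apply: eq_bigr => i _; rewrite mulrDl.
- move=> a _ Aa [c [Ac ->]]; exists (fun i => a * c i); split.
    by move=> i; apply: subringM.
  by rewrite mulr_sumr; apply: eq_bigr => i _; rewrite mulrA.
Qed.

Lemma noetherian_sums I : noetherian A -> ideal A I ->
  exists m (b : 'I_m -> K), (forall i, I (b i)) /\
    forall z, I z -> exists c : 'I_m -> K,
      (forall i, A (c i)) /\ z = \sum_i c i * b i.
Proof.
move=> nA hI; have [g [gI Ig]] := nA _ hI; case: (hI) => IA _ _ _.
exists (size g), (fun i => g`_i); split.
  by move=> i; apply: gI; rewrite mem_nth.
move=> z Iz; apply: (Ig _ (ideal_gen_sums _)) Iz => [a /gI/IA //|a ag].
have hi : (index a g < size g)%N by rewrite index_mem.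
exists (fun i => ((i : nat) == index a g)%:R); split.
  by move=> i; case: eqP => _; [apply: subring1|apply: subring0].
rewrite (bigD1 (Ordinal hi)) //= eqxx mul1r nth_index // big1 ?addr0 //.
by move=> i; rewrite -val_eqE /= => /negPf ->; rewrite mul0r.
Qed.

(** Otherwise choice gives a strictly increasing chain in [F]; its union is an ideal whose finitely
    many generators already lie in one term. *)
Lemma noetherian_max (F : set (set K)) : noetherian A -> F !=set0 ->
  (forall I, F I -> ideal A I) ->
  exists2 I, F I & forall J, F J -> I `<=` J -> J `<=` I.
Proof.
move=> nA [I0 FI0] hF; apply: contrapT => hno.
have next I : exists J, F I -> [/\ F J, I `<=` J & ~ J `<=` I].
  have [FI|nFI] := pselect (F I); last by exists I.
  apply: contrapT => hn; apply: hno; exists I => // J FJ IJ.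
  by apply: contrapT => JI; apply: hn; exists J.
have [nx hnx] := choice next.
pose s m := iter m nx I0.
have Fs m : F (s m) by elim: m => //= m /hnx [].
have sS m : s m `<=` s m.+1 by have [] := hnx _ (Fs m).
have mono m m' : (m <= m')%N -> s m `<=` s m'.
  move/subnK => <-; elim: (m' - m)%N => // j IH.
  by apply: subset_trans IH _; apply: sS.
have hU : ideal A (\bigcup_m s m).
  split.
  - by move=> a [m _ sa]; have [h _ _ _] := hF _ (Fs m); apply: h.
  - by exists 0%N => //; have [] := hF _ (Fs 0%N).
  - move=> a b [m _ sa] [m' _ sb]; exists (maxn m m') => //.
    have [_ _ h _] := hF _ (Fs (maxn m m')); apply: h.
      by apply: mono sa; apply: leq_maxl.
    by apply: mono sb; apply: leq_maxr.
  - move=> a b Aa [m _ sb]; exists m => //.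
    by have [_ _ _ h] := hF _ (Fs m); apply: h.
have [g [gU Ug]] := nA _ hU.
have [m hm] : exists m, forall a, a \in g -> s m a.
  elim: g gU {Ug} => [|a g IH] gU; first by exists 0%N.
  have [m hm] := IH (fun b bg => gU b (@mem_behead _ (a :: g) b bg)).
  have [m' _ sa] := gU a (mem_head _ _).
  exists (maxn m m') => b; rewrite inE => /orP[/eqP ->|/hm sb].
    by apply: mono sa; apply: leq_maxr.
  by apply: mono sb; apply: leq_maxl.
have [_ _] := hnx _ (Fs m); apply; apply: subset_trans (Ug _ (hF _ (Fs m)) hm).
by move=> a sa; exists m.+1.
Qed.

(* An associated prime of [A z + A] modulo [A]. *)
Lemma associated_prime z : noetherian A -> ~ A z ->
  exists2 c, A c & prime_ideal A [set s | A s /\ A (s * (c * z))].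
Proof.
move=> nA nAz; pose D c := [set s | A s /\ A (s * (c * z))].
have [] := @noetherian_max [set I | exists c, [/\ A c, ~ A (c * z) & I = D c]] nA.
- by exists (D 1), 1; rewrite mul1r; split=> //; apply: subring1.
- by move=> _ [c [_ _ ->]]; apply: ideal_denominators.
move=> _ [c [Ac ncz ->]] cmax; exists c => //.
have [h1 h2 h3 h4] := ideal_denominators (c * z).
split=> //; first by case; rewrite mul1r.
move=> a b Aa Ab [_ Dab].
have [Abc|nAbc] := pselect (A (b * (c * z))); first by right.
left; apply: (cmax (D (b * c))).
- by exists (b * c); split=> //; rewrite -?mulrA //; apply: subringM.
- move=> s [As Dc]; split=> //.
  by rewrite -mulrA mulrCA; apply: subringM.
- by split=> //; rewrite -mulrA mulrA.
Qed.

(** A substitute for Krull's intersection theorem: the ideals generated by the [z / t ^+ m] would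
    ascend, and where the chain stops, [z / t ^+ m.+1] is some [r] times [z / t ^+ m], so that
    [t^-1 = r]. *)
Lemma noetherian_no_divisible t z : noetherian A -> A t -> ~ A t^-1 -> z != 0 ->
  exists m, ~ A (z / t ^+ m).
Proof.
move=> nA At ntV z0; apply: contrapT => hn.
have hz m : A (z / t ^+ m) by apply: contrapT => h; apply: hn; exists m.
have t0 : t != 0 by apply/eqP => t0; apply: ntV; rewrite t0 invr0; apply: subring0.
pose P m := [set a | exists2 r, A r & a = r * (z / t ^+ m)].
have hP m : ideal A (P m).
  split.
  - by move=> _ [r Ar ->]; apply: subringM.
  - by exists 0; [apply: subring0|rewrite mul0r].
  - move=> _ _ [r Ar ->] [r' Ar' ->]; exists (r + r'); first exact: subringD.
    by rewrite mulrDl.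
  - by move=> a _ Aa [r Ar ->]; exists (a * r); [apply: subringM|rewrite mulrA].
have [] := @noetherian_max (range P) nA.
- by exists (P 0%N), 0%N.
- by move=> _ [m _ <-].
move=> _ [m _ <-] hmax.
have sub : P m `<=` P m.+1.
  move=> _ [r Ar ->]; exists (r * t); first exact: subringM.
  by rewrite exprS invfM -!mulrA; congr (r * _); rewrite [RHS]mulrCA mulVKf.
have [] := hmax _ (ex_intro2 _ _ m.+1 I erefl) sub (z / t ^+ m.+1).
  by exists 1; [apply: subring1|rewrite mul1r].
move=> r Ar e; apply: ntV; suff -> : t^-1 = r by [].
have zt0 : z / t ^+ m != 0 by rewrite mulf_neq0 // invr_neq0 // expf_neq0.
by apply: (mulIf zt0); rewrite -e exprS invfM mulrCA.
Qed.

End Ideals.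

Lemma prime_ideal_ideal (K : fieldType) (A P : set K) :
  prime_ideal A P -> ideal A P.
Proof. by case=> PA [P0 PD] PM _ _; split. Qed.

(** * Hilbert's basis theorem and finitely generated algebras *)

Section Hilbert.
Variables (K : fieldType) (A : set K) (g : K).
Hypothesis hA : subring A.

Definition adjoin : set K :=
  [set z | exists2 q : {poly K}, forall i, A q`_i & z = q.[g]].

Lemma adjoin_subring : subring adjoin.
Proof.
split.
- exists 1; last by rewrite hornerC.
  move=> i; rewrite coef1; case: eqP => _; [exact: subring1|exact: subring0].
- move=> _ _ [q hq ->] [r hr ->]; exists (q - r); last by rewrite !hornerE.
  by move=> i; rewrite coefB; apply: subringB.
- move=> _ _ [q hq ->] [r hr ->]; exists (q * r); last by rewrite hornerM.
  move=> i; rewrite coefM; elim/big_ind: _ => [|a b|j _]; first exact: subring0.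
    exact: subringD.
  exact: subringM.
Qed.

Lemma adjoin_sub : A `<=` adjoin.
Proof.
move=> a Aa; exists a%:P; last by rewrite hornerC.
by move=> i; rewrite coefC; case: eqP => _ //; apply: subring0.
Qed.

Lemma adjoin_gen : adjoin g.
Proof.
exists 'X; last by rewrite hornerX.
by move=> i; rewrite coefX; case: eqP => _; [exact: subring1|exact: subring0].
Qed.

Lemma adjoin_min B : subring B -> A `<=` B -> B g -> adjoin `<=` B.
Proof.
move=> hB AB Bg _ [q hq ->]; rewrite horner_coef.
elim/big_ind: _ => [|a b|i _]; first exact: subring0.
  exact: subringD.
by apply: subringM => //; [exact: AB|exact: subringX].
Qed.

(** An element of [adjoin] may have several expressions [q.[g]]. Admitting all of them amounts to
    taking leading coefficients in the preimage of [I] in [A[X]]; the bound on [size q] allows the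
    coefficient 0. *)
Let leads (I : set K) (m : nat) : set K :=
  [set a | exists q : {poly K},
     [/\ forall i, A q`_i, (size q <= m.+1)%N, q`_m = a & I q.[g]]].

Let leads_ideal I m : ideal adjoin I -> ideal A (leads I m).
Proof.
move=> [IB I0 ID IM]; split.
- by move=> _ [q [hq _ <- _]].
- exists 0; rewrite size_poly0 coef0 horner0; split=> //.
  by move=> i; rewrite coef0; apply: subring0.
- move=> _ _ [q [hq sq <- Iq]] [r [hr sr <- Ir]]; exists (q + r).
  rewrite coefD hornerD; split=> //; last exact: ID.
    by move=> i; rewrite coefD; apply: subringD.
  by apply: leq_trans (size_polyD _ _) _; rewrite geq_max sq sr.
- move=> a _ Aa [q [hq sq <- Iq]]; exists (a *: q).
  rewrite coefZ hornerZ; split=> //.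
  + by move=> i; rewrite coefZ; apply: subringM.
  + exact: leq_trans (size_scale_leq _ _) sq.
  + by apply: IM => //; apply: adjoin_sub.
Qed.

Let leads_mono I m m' : ideal adjoin I -> (m <= m')%N -> leads I m `<=` leads I m'.
Proof.
move=> [IB I0 ID IM] /subnK <-; elim: (m' - m)%N => // j IH.
apply: subset_trans IH _ => _ [q [hq sq <- Iq]]; exists (q * 'X).
split=> //.
- by move=> i; rewrite coefMX; case: eqP => _ //; apply: subring0.
- by apply: leq_trans (size_polyMleq _ _) _; rewrite size_polyX addn2.
- by rewrite coefMX.
- by rewrite hornerM hornerX mulrC; apply: IM => //; apply: adjoin_gen.
Qed.

(** Induction on the degree of an expression: subtracting an element of [J] with the same top
    coefficient lowers it. *)
Let leads_sub I J : ideal adjoin I -> ideal adjoin J -> J `<=` I ->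
  (forall m, leads I m `<=` leads J m) -> I `<=` J.
Proof.
move=> hI hJ JI hl z Iz; have [IB _ _ _] := hI.
have [q hq zq] := IB _ Iz; move: Iz; rewrite zq.
elim: {q}(size q) {-2}q (leqnn (size q)) hq {zq z} => [|m IH] q sq hq Iq.
  by move: sq; rewrite leqn0 size_poly_eq0 => /eqP ->; rewrite horner0; case: hJ.
have [r [hr sr er Jr]] := hl m (q`_m) (ex_intro _ q (And4 hq sq erefl Iq)).
rewrite -(subrK r q) hornerD; have [_ _ JD _] := hJ; apply: JD => //.
apply: IH.
- apply/leq_sizeP => j; rewrite leq_eqVlt => /orP[/eqP <-|mj].
    by rewrite coefB er subrr.
  by rewrite coefB !nth_default ?subrr // (leq_trans _ mj).
- by move=> i; rewrite coefB; apply: subringB.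
- by rewrite hornerD hornerN; apply: (idealB adjoin_subring hI) => //; apply: JI.
Qed.

Lemma hilbert_basis : noetherian A -> noetherian adjoin.
Proof.
move=> nA I hI; have [IB I0 ID IM] := hI.
pose Linf := \bigcup_m leads I m.
have hLinf : ideal A Linf.
  split.
  - by move=> a [m _ la]; have [h _ _ _] := leads_ideal m hI; apply: h.
  - by exists 0%N => //; have [] := leads_ideal 0 hI.
  - move=> a b [m _ la] [m' _ lb]; exists (maxn m m') => //.
    have [_ _ h _] := leads_ideal (maxn m m') hI; apply: h.
      by apply: leads_mono la => //; apply: leq_maxl.
    by apply: leads_mono lb => //; apply: leq_maxr.
  - move=> a b Aa [m _ lb]; exists m => //.
    by have [_ _ _ h] := leads_ideal m hI; apply: h.
have [ginf [ginfL Linfg]] := nA _ hLinf.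
have [N hN] : exists N, forall a, a \in ginf -> leads I N a.
  elim: ginf ginfL {Linfg} => [|a s IH] sL; first by exists 0%N.
  have [m hm] := IH (fun b bs => sL b (@mem_behead _ (a :: s) b bs)).
  have [m' _ la] := sL a (mem_head _ _).
  exists (maxn m m') => b; rewrite inE => /orP[/eqP ->|/hm lb].
    by apply: leads_mono la => //; apply: leq_maxr.
  by apply: leads_mono lb => //; apply: leq_maxl.
have [gen hgen] := choice (fun m => nA _ (leads_ideal m hI)).
(* In degree [N] the list generates the union of all [leads I m], so together with multiplication by
   powers of [g] it serves every degree from [N] on. *)
pose gens m := if m == N then ginf else gen m.
have hgens m a : a \in gens m -> leads I m a.
  by rewrite /gens; case: eqP => [->|_]; [exact: hN|have [h _] := hgen m; exact: h].
have wit (u : nat * K) : exists q : {poly K}, leads I u.1 u.2 ->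
    [/\ forall i, A q`_i, (size q <= u.1.+1)%N, q`_u.1 = u.2 & I q.[g]].
  by have [[q hq]|nq] := pselect (leads I u.1 u.2); [exists q|exists 0].
have [w hw] := choice wit.
exists [seq (w (m, a)).[g] | m <- iota 0 N.+1, a <- gens m]; split.
  by move=> _ /allpairsPdep[m [a [_ /hgens la ->]]]; have [] := hw (m, a) la.
move=> J hJ gJ.
have hIJ := idealI hI hJ.
suff : I `<=` I `&` J by move=> h z /h [].
apply: leads_sub => //.
have small m a : (m <= N)%N -> a \in gens m -> leads (I `&` J) m a.
  move=> mN ag; have [h1 h2 h3 h4] := hw (m, a) (hgens _ _ ag).
  exists (w (m, a)); split=> //; split=> //; apply: gJ.
  by apply/allpairsPdep; exists m, a; rewrite mem_iota ltnS.
have big m : (N <= m)%N -> leads I m `<=` leads (I `&` J) m.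
  move=> Nm; apply: subset_trans (leads_mono hIJ Nm).
  apply: (@subset_trans _ Linf); first by move=> a la; exists m.
  apply: Linfg; first exact: leads_ideal.
  by move=> a ag; apply: small => //; rewrite /gens eqxx.
move=> m; have [/big //|mN] := leqP N m.
have [_ h] := hgen m; apply: h; first exact: leads_ideal.
by move=> a ag; apply: small; [exact: ltnW|rewrite /gens ltn_eqF].
Qed.

End Hilbert.

Lemma noetherian_field (k K : fieldType) (i : {rmorphism k -> K}) :
  noetherian (range i).
Proof.
move=> I [IA I0 _ IM].
have [[a Ia a0]|hn] := pselect (exists2 a, I a & a != 0); last first.
  exists [::]; split=> // J [_ J0 _ _] _ z Iz; suff -> : z = 0 by [].
  by apply: contrapT => /eqP z0; apply: hn; exists z.
have [c _ ca] := IA _ Ia.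
exists [:: a]; split=> [b|J [JA J0 _ JM] aJ z /IA [e _ <-]].
  by rewrite inE => /eqP ->.
have -> : i e = i (e / c) * a.
  rewrite -ca -rmorphM divfK //; apply: contra_neq a0 => c0.
  by rewrite -ca c0 rmorph0.
by apply: JM; [exists (e / c)|apply: aJ; rewrite mem_head].
Qed.

Lemma noetherian_fg_algebra (k K : fieldType) (i : {rmorphism k -> K})
    (g : seq K) :
  exists A : set K, [/\ subring A, noetherian A, range i `<=` A,
    (forall a, a \in g -> A a) &
    forall B, subring B -> range i `<=` B -> (forall a, a \in g -> B a) -> A `<=` B].
Proof.
elim: g => [|a g [A [hA nA iA gA Amin]]].
  exists (range i); split=> //; last exact: noetherian_field.
  split; first by exists 1; rewrite ?rmorph1.
    by move=> _ _ [a _ <-] [b _ <-]; exists (a - b); rewrite ?rmorphB.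
  by move=> _ _ [a _ <-] [b _ <-]; exists (a * b); rewrite ?rmorphM.
exists (adjoin A a); split.
- exact: adjoin_subring.
- exact: hilbert_basis.
- by apply: subset_trans iA (adjoin_sub _ hA).
- move=> b; rewrite inE => /orP[/eqP ->|/gA Ab]; first exact: adjoin_gen.
  exact: adjoin_sub.
- move=> B hB iB gB; apply: adjoin_min => //; last by apply: gB; rewrite mem_head.
  by apply: Amin => // b bg; apply: gB; rewrite inE bg orbT.
Qed.

(** An ideal of [R] is generated by its intersection with [A], since denominators are invertible in
    [R]. *)
Lemma noetherian_localization (K : fieldType) (A R : set K) :
  subring A -> A `<=` R -> noetherian A ->
  (forall z, R z -> exists a s, [/\ A a, A s, R s^-1, s != 0 & z = a / s]) ->
  noetherian R.
Proof.
move=> hA AR nA hR I [IR I0 ID IM].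
have hIA : ideal A (I `&` A).
  split.
  - by move=> a [].
  - by split=> //; apply: subring0.
  - by move=> a b [Ia Aa] [Ib Ab]; split; [apply: ID|apply: subringD].
  - by move=> a b Aa [Ib Ab]; split; [apply: IM => //; apply: AR|apply: subringM].
have [g [gI Ig]] := nA _ hIA.
exists g; split=> [a /gI [] //|J [JR J0 JD JM] gJ z Iz].
have [a [s [Aa As RsV s0 ez]]] := hR _ (IR _ Iz).
have [Ja _] : (J `&` A) a.
  apply: Ig.
  - split.
    + by move=> b [].
    + by split=> //; apply: subring0.
    + by move=> b c [Jb Ab] [Jc Ac]; split; [apply: JD|apply: subringD].
    + by move=> b c Ab [Jc Ac]; split; [apply: JM => //; apply: AR|apply: subringM].
  - by move=> b bg; split; [apply: gJ|have [] := gI _ bg].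
  - split=> //; have -> : a = s * z by rewrite ez mulrC divfK.
    by apply: IM => //; apply: AR.
by rewrite ez mulrC; apply: JM.
Qed.

(** * Units, non-units and uniformizers in a subring of a field *)

Section Units.
Variables (K : fieldType) (R : set K).
Hypothesis hR : subring R.

Lemma unit_of1 : unit_of R 1.
Proof. by split; rewrite ?invr1 ?oner_neq0 //; apply: subring1. Qed.

Lemma unit_ofM a b : unit_of R a -> unit_of R b -> unit_of R (a * b).
Proof.
move=> [a0 Ra RaV] [b0 Rb RbV]; split; rewrite ?mulf_neq0 ?invfM //;
  exact: subringM.
Qed.

Lemma unit_ofV a : unit_of R a -> unit_of R a^-1.
Proof. by move=> [a0 Ra RaV]; split; rewrite ?invr_eq0 ?invrK. Qed.

Lemma unit_ofX a m : unit_of R a -> unit_of R (a ^+ m).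
Proof.
move=> ua; elim: m => [|m IH]; first by rewrite expr0; apply: unit_of1.
by rewrite exprS; apply: unit_ofM.
Qed.

Lemma unit_ofXz a (m : int) : unit_of R a -> unit_of R (a ^ m).
Proof.
case: m => m ua; first exact: unit_ofX.
exact: unit_ofV (unit_ofX m.+1 ua).
Qed.

Lemma unit_of_factor a b : R a -> R b -> unit_of R (a * b) -> unit_of R a.
Proof.
move=> Ra Rb [ab0 _ RabV]; have [a0 b0] : a != 0 /\ b != 0.
  by move: ab0; rewrite mulf_eq0 negb_or => /andP[].
split=> //; have -> : a^-1 = b * (a * b)^-1 by rewrite invfM mulrA [b * _]mulrC mulfK.
exact: subringM.
Qed.

Definition nonunits : set K := [set s | R s /\ ~ unit_of R s].

Lemma nonunits0 : nonunits 0.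
Proof. by split; [apply: subring0|case; rewrite eqxx]. Qed.

Lemma nonunits_mul a b : R a -> nonunits b -> nonunits (a * b).
Proof.
move=> Ra [Rb nub]; split; first exact: subringM.
by rewrite mulrC => /unit_of_factor h; apply: nub; apply: h.
Qed.

Lemma nonunits_prime a b : R a -> R b -> nonunits (a * b) -> nonunits a \/ nonunits b.
Proof.
move=> Ra Rb [_ nu].
have [ua|] := pselect (unit_of R a); last by left.
by right; split=> // ub; apply: nu; apply: unit_ofM.
Qed.

(* If [m] is the maximal ideal and [y m] lies in [R], then [y m] is [m] or [R];
   the first makes [y] integral by Cayley-Hamilton, the second makes
   [y^-1] a generator of [m]. *)
Lemma nonunits_principal y : noetherian R -> integrally_closed R ->
  ideal R nonunits -> ~ R y -> (forall s, nonunits s -> R (s * y)) ->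
  (exists2 s, nonunits s & s != 0) ->
  nonunits y^-1 /\ forall s, nonunits s -> exists2 a, R a & s = a * y^-1.
Proof.
move=> nR cR hm nRy hy [s1 ms1 s10].
have y0 : y != 0 by apply/eqP => y0; apply: nRy; rewrite y0; apply: subring0.
split; last by move=> s ms; exists (s * y); [apply: hy|rewrite mulfK].
have [[s0 ms0 us0]|hn] := pselect (exists2 s, nonunits s & unit_of R (s * y)).
  have [h0 _ hV] := us0.
  have s00 : s0 != 0 by move: h0; rewrite mulf_eq0 negb_or => /andP[].
  have -> : y^-1 = (s0 * y)^-1 * s0 by rewrite invfM -mulrA [_ * s0]mulrC mulrA mulVf ?mul1r.
  exact: nonunits_mul.
have [m [b [mb hb]]] := noetherian_sums hR nR hm.
have hyb i : exists c : 'I_m -> K, (forall j, R (c j)) /\ b i * y = \sum_j c j * b j.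
  apply: hb; split; first exact: hy.
  by move=> u; apply: hn; exists (b i).
have [c hc] := choice hyb.
have [q [qm Rq rq]] : exists q : {poly K},
    [/\ q \is monic, forall i, R q`_i & root (map_poly idfun q) y].
  apply: (@det_trick _ _ idfun R m b c) => //.
  - apply: contrapT => hb0; move/eqP: s10; apply; have [e [_ ->]] := hb _ ms1.
    rewrite big1 // => i _; suff -> : b i = 0 by rewrite mulr0.
    by apply: contrapT => /eqP bi0; apply: hb0; exists i.
  - by move=> i j; have [h _] := hc i; apply: h.
  - by move=> i; have [_ h] := hc i; rewrite mulrC h.
by case: nRy; apply: cR; exists q; split=> //; rewrite map_poly_id in rq.
Qed.

(** For [z] in [R] the exponent is the last [m] with [z / t ^+ m] in [R]; this quotient is a unit,
    as a non-unit would be divisible by [t] once more. *)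
Lemma uniformizer_decomposition t :
  noetherian R -> nonunits t -> t != 0 ->
  (forall s, nonunits s -> exists2 a, R a & s = a * t) ->
  (forall z, exists a s, [/\ R a, R s, s != 0 & z = a / s]) ->
  forall z, z != 0 -> exists u (m : int), unit_of R u /\ z = u * t ^ m.
Proof.
move=> nR [Rt nut] t0 ht hfrac.
have ntV : ~ R t^-1 by move=> h; apply: nut.
have pos z : R z -> z != 0 -> exists u (m : nat), unit_of R u /\ z = u * t ^+ m.
  move=> Rz z0.
  have [m [Rm nRm]] : exists m, R (z / t ^+ m) /\ ~ R (z / t ^+ m.+1).
    apply: contrapT => hn; have [m] := noetherian_no_divisible hR nR Rt ntV z0.
    apply; elim: m => [|m IH]; first by rewrite expr0 divr1.
    by apply: contrapT => h; apply: hn; exists m.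
  exists (z / t ^+ m), m; split; last by rewrite divfK // expf_neq0.
  apply: contrapT => nu; have [a Ra ea] := ht _ (conj Rm nu).
  by apply: nRm; rewrite exprS invfM mulrCA ea mulrCA mulVf // mulr1.
move=> z z0; have [a [s [Ra Rs s0 ez]]] := hfrac z.
have a0 : a != 0 by apply: contra_neq z0 => a0; rewrite ez a0 mul0r.
have [u [m [uu eu]]] := pos a Ra a0; have [v [l [vv ev]]] := pos s Rs s0.
exists (u / v), (m%:Z - l%:Z); split; first by apply: unit_ofM => //; apply: unit_ofV.
by rewrite ez eu ev expfzDr // -exprnP -exprnN invfM mulrACA.
Qed.

End Units.

(** * Local rings of a normal variety *)

Section Scheme.
Variables (k : fieldType) (X : ratspace k).
Hypothesis hX : normal_variety X.
Local Notation K := (funfield X).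
Local Notation O := (@sections k X).
Implicit Types (x y : X) (U V W : set X) (z s : K).

Let int_X : integral_scheme X. Proof. by case: hX => [[]]. Qed.

(** [closure [set y] x] is the form in which [y] is called a generization of [x] below. *)
Lemma closure1P (x y : X) :
  closure [set y] x <-> forall N : set X, open N -> N x -> N y.
Proof.
split=> [h N oN Nx|h B]; first by have [_ [-> ]] := h N (open_nbhs_nbhs (conj oN Nx)).
rewrite nbhsE => -[N [oN Nx] NB]; exists y; split=> //.
by apply: NB; apply: h.
Qed.

Lemma irreducible_openI (U V : set X) :
  nonempty_open U -> nonempty_open V -> nonempty_open (U `&` V).
Proof.
move=> hU hV; split; first by apply: openI; [case: hU|case: hV].
by have [[_ h] _ _ _ _] := int_X; apply: h.
Qed.

Lemma sections_subring U : nonempty_open U -> subring (O U).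
Proof. by have [_ h _ _ _] := int_X => /h []. Qed.

Lemma sections_scalars U c : nonempty_open U -> O U (scalars X c).
Proof. by have [_ h _ _ _] := int_X => /h []. Qed.

Lemma sections_glue (C : set (set X)) : C !=set0 -> C `<=` @nonempty_open _ X ->
  O (\bigcup_(V in C) V) = \bigcap_(V in C) O V.
Proof. by have [_ _ h _ _] := int_X; apply: h. Qed.

(** Restriction is gluing for the covering of [U] by [U] and [V]. *)
Lemma sections_mono U V : nonempty_open U -> nonempty_open V -> V `<=` U ->
  O U `<=` O V.
Proof.
move=> hU hV VU z Oz.
have e : \bigcup_(W in [set U; V]) W = U.
  by rewrite bigcup_setU !bigcup_set1; apply/setUidPl.
have : O (\bigcup_(W in [set U; V]) W) z by rewrite e.
rewrite sections_glue; first by apply; right.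
  by exists U; left.
by move=> W [->|->].
Qed.

Lemma nonempty_open_of (U : set X) x : open U -> U x -> nonempty_open U.
Proof. by move=> oU Ux; split=> //; exists x. Qed.

Lemma stalk_sections U x : open U -> U x -> O U `<=` stalk x.
Proof. by move=> oU Ux z Oz; exists U. Qed.

Lemma stalk_common (l : seq K) x : (forall a, a \in l -> stalk x a) ->
  exists U, [/\ open U, U x & forall a, a \in l -> O U a].
Proof.
elim: l => [|a l IH] hs.
  have [_ _ _ h _] := int_X; have [U [[oU _] _ _ _ _] Ux] := h x.
  by exists U.
have [U [oU Ux lU]] := IH (fun b bl => hs b (@mem_behead _ (a :: l) b bl)).
have [V [oV Vx] Va] := hs a (mem_head _ _).
have hU := nonempty_open_of oU Ux; have hV := nonempty_open_of oV Vx.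
have hUV := irreducible_openI hU hV.
exists (U `&` V); split=> //; first exact: openI.
move=> b; rewrite inE => /orP[/eqP ->|/lU Ub].
  by apply: sections_mono Va => //; apply: subIsetr.
by apply: sections_mono Ub => //; apply: subIsetl.
Qed.

Lemma stalk_subring x : subring (stalk x).
Proof.
have two a b : stalk x a -> stalk x b -> exists U, [/\ open U, U x, O U a & O U b].
  move=> ha hb; have [|U [oU Ux sU]] := @stalk_common [:: a; b] x.
    by move=> c; rewrite !inE => /orP[] /eqP ->.
  by exists U; split=> //; apply: sU; rewrite !inE eqxx ?orbT.
split.
- have [U [oU Ux _]] := @stalk_common [::] x (fun a h => False_ind _ (notF h)).
  exists U => //; apply: subring1; apply: sections_subring.
  exact: nonempty_open_of Ux.
- move=> a b /two h /h [U [oU Ux Ua Ub]]; exists U => //.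
  by apply: subringB => //; apply: sections_subring; apply: nonempty_open_of Ux.
- move=> a b /two h /h [U [oU Ux Ua Ub]]; exists U => //.
  by apply: subringM => //; apply: sections_subring; apply: nonempty_open_of Ux.
Qed.

Lemma max_idealP x s : stalk x s -> (~ max_ideal x s <-> unit_of (stalk x) s).
Proof.
move=> hs; split=> [h|hu [_]//]; apply: contrapT => nu; exact: h.
Qed.

Lemma affine_nbhd x : exists2 U, affine_open U & U x.
Proof. by have [_ _ _ h _] := int_X. Qed.

Lemma affine_nonempty (U : set X) : affine_open U -> nonempty_open U.
Proof. by case. Qed.

Lemma affine_open_open (U : set X) : affine_open U -> open U.
Proof. by case=> [[]]. Qed.

Lemma affine_subring (U : set X) : affine_open U -> subring (O U).
Proof. by move/affine_nonempty/sections_subring. Qed.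

Lemma max_ideal0 x : max_ideal x 0.
Proof. exact: nonunits0 (stalk_subring x). Qed.

(** * Points and stalks of an affine open set *)

Section Affine.
Variable V : set X.
Hypothesis hV : affine_open V.

Lemma affine_prime x : V x -> prime_ideal (O V) (O V `&` max_ideal x).
Proof. by case: hV => _ h _ _ _; apply: h. Qed.

Lemma affine_point P : prime_ideal (O V) P ->
  exists2 x, V x & O V `&` max_ideal x = P.
Proof. by case: hV => _ _ h _ _ /h [x [[Vx e] _]]; exists x. Qed.

Lemma affine_point_inj x y : V x -> V y ->
  O V `&` max_ideal x = O V `&` max_ideal y -> x = y.
Proof.
case: (hV) => _ _ h _ _ Vx Vy e.
have [z [_ hz]] := h _ (affine_prime Vx).
by rewrite -(hz x) // -(hz y).
Qed.

Lemma affine_basis W x : open W -> V x -> W x ->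
  exists s, [/\ O V s, s != 0, ~ max_ideal x s &
    V `&` [set y | ~ max_ideal y s] `<=` W].
Proof.
case: (hV) => [[oV _] _ _ hopen _] oW Vx Wx.
have [h _] := hopen (V `&` W) (@subIsetl _ V W).
have [S SV e] := h (openI oV oW).
have : (V `&` W) x by [].
rewrite {1}e => -[_ [s Ss ms]].
exists s; split=> //; first exact: SV.
  by apply/eqP => s0; apply: ms; rewrite s0; apply: max_ideal0.
move=> y [Vy my]; suff [] : (V `&` W) y by [].
by rewrite e; split=> //; exists s.
Qed.

Lemma affine_basic_open s : O V s -> open (V `&` [set y | ~ max_ideal y s]).
Proof.
case: (hV) => _ _ _ hopen _ Vs; apply/hopen; first exact: subIsetl.
exists [set s]; first by move=> _ ->.
by apply/seteqP; split=> y [Vy my]; split=> //; [exists s|case: my => _ ->].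
Qed.

Lemma affine_basic_sections s : O V s -> s != 0 ->
  O (V `&` [set x | ~ max_ideal x s]) = [set z | exists a m, O V a /\ z = a / s ^+ m].
Proof. by case: hV => _ _ _ _ h; apply: h. Qed.

Lemma affine_max_idealX x s m : V x -> O V s -> ~ max_ideal x s ->
  ~ max_ideal x (s ^+ m).
Proof.
move=> Vx Vs ms; have hs : stalk x s.
  by apply: stalk_sections Vs => //; apply: affine_open_open.
case=> _; apply; apply: unit_ofX; first exact: stalk_subring.
exact/max_idealP.
Qed.

Lemma stalk_affine x z : V x -> stalk x z ->
  exists a s, [/\ O V a, O V s, ~ max_ideal x s, s != 0 & z = a / s].
Proof.
move=> Vx [W [oW Wx] Wz].
have [s [Vs s0 ms sW]] := affine_basis oW Vx Wx.
have : O (V `&` [set y | ~ max_ideal y s]) z.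
  apply: sections_mono Wz => //; first exact: nonempty_open_of Wx.
  by apply: (@nonempty_open_of _ x) => //; apply: affine_basic_open.
rewrite affine_basic_sections // => -[a [m [Va ->]]].
exists a, (s ^+ m); split=> //.
- by apply: subringX => //; apply: affine_subring.
- exact: affine_max_idealX.
- exact: expf_neq0.
Qed.

Lemma stalk_affine_sub x : V x -> O V `<=` stalk x.
Proof. by apply: stalk_sections; apply: affine_open_open. Qed.

Lemma funfield_affine z : exists a s, [/\ O V a, O V s, s != 0 & z = a / s].
Proof.
have [_ _ _ _ h] := int_X.
have [W hW Wz] : (\bigcup_(U in @nonempty_open _ X) O U) z by rewrite h.
have [oVW [x [Vx Wx]]] := irreducible_openI (affine_nonempty hV) hW.
have [|a [s [Va Vs _ s0 ez]]] := @stalk_affine x z Vx; last by exists a, s.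
by exists W => //; split=> //; case: hW.
Qed.

Lemma affine_generic : exists2 x, V x & forall s, O V s -> max_ideal x s -> s = 0.
Proof.
have hA := affine_subring hV.
have [x Vx e] : exists2 x, V x & O V `&` max_ideal x = [set 0].
  apply: affine_point; split.
  - by move=> _ ->; apply: subring0.
  - by split=> // a b -> ->; rewrite addr0.
  - by move=> a _ _ ->; rewrite /= mulr0.
  - by move/eqP; rewrite oner_eq0.
  - by move=> a b _ _ /eqP; rewrite mulf_eq0 => /orP[] /eqP; [left|right].
by exists x => // s Vs ms; have : [set 0 : K] s by rewrite -e.
Qed.

Lemma closure_affine x y : V x -> V y -> O V `&` max_ideal y `<=` max_ideal x ->
  closure [set y] x.
Proof.
move=> Vx Vy h; apply/closure1P => W oW Wx.
have [s [Vs _ ms sW]] := affine_basis oW Vx Wx.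
by apply: sW; split=> // my; apply: ms; apply: h.
Qed.

End Affine.

Lemma stalk_frac x z : exists a s, [/\ stalk x a, stalk x s, s != 0 & z = a / s].
Proof.
have [V hV Vx] := affine_nbhd x; have [a [s [Va Vs s0 ez]]] := funfield_affine hV z.
by exists a, s; split=> //; apply: (stalk_affine_sub hV).
Qed.

(** [max_ideal] consists of the non-units, so closure under addition is the locality of the stalk.
    It comes from the prime ideal of an affine neighbourhood after clearing denominators. *)
Lemma max_ideal_ideal x : ideal (stalk x) (max_ideal x).
Proof.
have hR := stalk_subring x; split.
- by move=> s [].
- exact: max_ideal0.
- move=> a b [Ra nua] [Rb nub]; split; first exact: subringD.
  have [V hV Vx] := affine_nbhd x; have AR := stalk_affine_sub hV Vx.
  have [a1 [s [Aa As ms s0 ea]]] := stalk_affine hV Vx Ra.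
  have [b1 [t [Ab At mt t0 eb]]] := stalk_affine hV Vx Rb.
  have us : unit_of (stalk x) s by apply/max_idealP => //; apply: AR.
  have ut : unit_of (stalk x) t by apply/max_idealP => //; apply: AR.
  have ma : max_ideal x a1.
    by rewrite -[a1](divfK s0) -ea mulrC; apply: nonunits_mul => //; apply: AR.
  have mb : max_ideal x b1.
    by rewrite -[b1](divfK t0) -eb mulrC; apply: nonunits_mul => //; apply: AR.
  have [_ [_ PD] PM _ _] := affine_prime hV Vx.
  have [_ [_ +]] : (O V `&` max_ideal x) (t * a1 + s * b1).
    by apply: PD; apply: PM.
  move=> nu uab; apply: nu.
  have -> : t * a1 + s * b1 = (a + b) * (s * t).
    rewrite -[a1](divfK s0) -[b1](divfK t0) -ea -eb.
    by ring.
  by apply: unit_ofM => //; apply: unit_ofM.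
- by move=> a b Ra; apply: nonunits_mul.
Qed.

Lemma max_ideal_prime x : prime_ideal (stalk x) (max_ideal x).
Proof.
have hR := stalk_subring x; have [mR m0 mD mM] := max_ideal_ideal x; split=> //.
  by case=> _ []; apply: unit_of1.
by move=> a b; apply: nonunits_prime.
Qed.

Lemma closure_stalk x y : closure [set y] x -> stalk x `<=` stalk y.
Proof. by move=> /closure1P h z [U [oU Ux] Uz]; exists U => //; split=> //; apply: h. Qed.

Lemma closure_max_ideal x y s : closure [set y] x -> stalk x s -> max_ideal y s ->
  max_ideal x s.
Proof.
move=> h hs [_ nu]; split=> // -[s0 _ sV]; apply: nu.
by split=> //; apply: closure_stalk h _ _.
Qed.

Lemma generic_in_open x (U : set X) : max_ideal x `<=` [set 0] -> nonempty_open U -> U x.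
Proof.
move=> mx hU; have [V hV Vx] := affine_nbhd x.
have [_ [z [Vz Uz]]] := irreducible_openI (affine_nonempty hV) hU.
have [s [Vs s0 _ sU]] := affine_basis hV (proj1 hU) Vz Uz.
by apply: sU; split=> // /mx; apply/eqP.
Qed.

Lemma genericP x : closure [set x] = [set: X] <-> max_ideal x `<=` [set 0].
Proof.
split=> [e s ms|h]; last first.
  apply/seteqP; split=> // y _; apply/closure1P => N oN Ny.
  by apply: generic_in_open => //; apply: nonempty_open_of Ny.
have [V hV Vx] := affine_nbhd x.
have hs : stalk x s by case: ms.
have [a [t [Va Vt mt t0 es]]] := stalk_affine hV Vx hs.
have [y Vy hy] := affine_generic hV.
have ma : max_ideal x a.
  rewrite -[a](divfK t0) -es mulrC; apply: nonunits_mul => //.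
    exact: stalk_subring.
  exact: (stalk_affine_sub hV Vx).
have cl : closure [set x] y by rewrite e.
have /hy a0 : max_ideal y a.
  by apply: closure_max_ideal cl _ ma; apply: (stalk_affine_sub hV Vy).
by rewrite es a0 // mul0r.
Qed.

Lemma max_ideal_affine0 V x : affine_open V -> V x ->
  (forall s, O V s -> max_ideal x s -> s = 0) -> max_ideal x `<=` [set 0].
Proof.
move=> hV Vx h s ms; have hs : stalk x s by case: ms.
have [a [t [Va Vt mt t0 es]]] := stalk_affine hV Vx hs.
rewrite es (h a) ?mul0r //.
rewrite -[a](divfK t0) -es mulrC; apply: nonunits_mul => //.
  exact: stalk_subring.
exact: (stalk_affine_sub hV Vx).
Qed.

Lemma codim1_max_ideal_neq0 x : codim1 x -> exists2 s, max_ideal x s & s != 0.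
Proof.
case=> nx _; apply: contrapT => hn; apply: nx; apply/genericP => s ms.
by apply: contrapT => /eqP s0; apply: hn; exists s.
Qed.

(** The smallest subalgebra on finitely many generators is the one obtained by adjoining them one by
    one. *)
Lemma affine_noetherian_nbhd x : exists U, [/\ affine_open U, U x & noetherian (O U)].
Proof.
have [[_ [C [_ CX hC]] _] _] := hX.
have [U CU Ux] : (\bigcup_(U in C) U) x by rewrite CX.
have [hU [g eg]] := hC _ CU; exists U; split=> //.
have [A [hA nA kA gA Amin]] := noetherian_fg_algebra (scalars X) g.
suff -> : O U = A by [].
rewrite eg; apply/seteqP; split.
  move=> z; apply; split; last by move=> a; apply: gA.
  by split=> // c; apply: kA; exists c.
by move=> z Az B [[hB kB] gB]; apply: Amin Az => // _ [c _ <-]; exact: kB.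
Qed.

Lemma stalk_noetherian x : noetherian (stalk x).
Proof.
have [U [hU Ux nU]] := affine_noetherian_nbhd x.
have AR := stalk_affine_sub hU Ux.
apply: (@noetherian_localization _ (O U)) => //; first exact: affine_subring.
move=> z hz; have [a [s [Ua Us ms s0 ez]]] := stalk_affine hU Ux hz.
by exists a, s; split=> //; have [] : unit_of (stalk x) s by apply/max_idealP => //; apply: AR.
Qed.

Lemma stalk_integrally_closed x : integrally_closed (stalk x).
Proof. by case: hX => _; apply. Qed.

(* The prime [Q] of the local ring of [x] is the local ring data of a
   generization [y] of [x]. *)
Lemma stalk_prime x Q : prime_ideal (stalk x) Q ->
  exists y, [/\ closure [set y] x,
    (forall s, stalk x s -> (max_ideal y s <-> Q s)) &
    (forall z, stalk y z -> exists a s, [/\ stalk x a, stalk x s, ~ Q s, s != 0 & z = a / s])].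
Proof.
move=> [QR [Q0 QD] QM Q1 Qp].
have [V hV Vx] := affine_nbhd x; have AR := stalk_affine_sub hV Vx.
have hR := stalk_subring x.
have [y Vy e] : exists2 y, V y & O V `&` max_ideal y = O V `&` Q.
  apply: affine_point; first exact: hV.
  have hA := affine_subring hV.
  split.
  - by move=> s [].
  - by split; [split=> //; apply: subring0|move=> a b [Va Qa] [Vb Qb]; split;
      [apply: subringD|apply: QD]].
  - by move=> a b Va [Vb Qb]; split; [apply: subringM|apply: QM => //; apply: AR].
  - by case.
  - move=> a b Va Vb [_ Qab].
    have [Qa|Qb] := Qp a b (AR _ Va) (AR _ Vb) Qab; [by left|by right].
have Qm s : Q s -> max_ideal x s.
  move=> Qs; split; first exact: QR.
  by move=> [s0 _ sV]; apply: Q1; rewrite -(mulVf s0); apply: QM.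
have cl : closure [set y] x.
  apply: (closure_affine hV) => // s ms.
  by have [_ /Qm] : (O V `&` Q) s by rewrite -e.
have mQ s : O V s -> max_ideal y s <-> Q s.
  move=> Vs; split=> h; first by have [] : (O V `&` Q) s by rewrite -e.
  by have [] : (O V `&` max_ideal y) s by rewrite e.
exists y; split=> //.
- move=> s hs; have [a [t [Va Vt mt t0 es]]] := stalk_affine hV Vx hs.
  have ea : a = t * s by rewrite es mulrC divfK.
  have hy := stalk_affine_sub hV Vy.
  have hRy := stalk_subring y.
  have [_ _ tV] : unit_of (stalk x) t by apply/max_idealP => //; apply: AR.
  split=> h.
    rewrite es mulrC; apply: QM => //; apply/mQ => //.
    by rewrite ea; apply: nonunits_mul => //; apply: hy.
  rewrite es mulrC; apply: nonunits_mul => //; first exact: closure_stalk cl _ _.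
  by apply/mQ => //; rewrite ea; apply: QM => //; apply: AR.
- move=> z hz; have [a [s [Va Vs ms s0 ez]]] := stalk_affine hV Vy hz.
  exists a, s; split=> //; try exact: AR.
  by move/(mQ _ Vs).
Qed.

(** [Q] belongs to a generization of [x], hence to [x] itself or to the generic point; the nonzero
    element [a] rules out the latter. *)
Lemma codim1_prime x Q a : codim1 x -> prime_ideal (stalk x) Q -> Q a -> a != 0 ->
  max_ideal x `<=` Q.
Proof.
move=> [_ hx] hQ Qa a0; have [y [cl mQ _]] := stalk_prime hQ.
have Ra : stalk x a by case: hQ => QR _ _ _ _; apply: QR.
have [e|/genericP my] := hx y cl.
  by move=> s ms; apply/mQ; [case: ms|rewrite e].
by move/eqP: a0; case; apply: my; apply/mQ.
Qed.

Lemma inverse_uniformizer x (y : K) : ~ stalk x y ->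
  (forall s, max_ideal x s -> stalk x (s * y)) ->
  (exists2 s, max_ideal x s & s != 0) -> uniformizer x y^-1.
Proof.
move=> ny hy hm; apply: nonunits_principal => //.
- exact: stalk_subring.
- exact: stalk_noetherian.
- exact: stalk_integrally_closed.
- exact: max_ideal_ideal.
Qed.

(** For a nonzero non-unit [s], an associated prime of [s^-1] modulo the stalk contains [s], hence
    the whole maximal ideal. So [c / s] is not regular but multiplies the maximal ideal into the
    stalk, and normality makes its inverse a uniformizer. *)
Lemma codim1_uniformizer x : codim1 x -> exists2 t, uniformizer x t & t != 0.
Proof.
move=> cx; have [s ms s0] := codim1_max_ideal_neq0 cx.
have hR := stalk_subring x.
have [Rs nus] := ms.
have nsV : ~ stalk x s^-1 by move=> h; apply: nus.
have [c Rc hQ] := associated_prime hR (@stalk_noetherian x) nsV.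
set Q := (X in prime_ideal _ X) in hQ.
have Qs : Q s by split=> //; rewrite mulrCA mulfV // mulr1.
have mQ := codim1_prime cx hQ Qs s0.
have ny : ~ stalk x (c / s).
  by move=> h; have [_ _ _ h1 _] := hQ; apply: h1; split; [apply: subring1|rewrite mul1r].
exists (c / s)^-1.
  apply: inverse_uniformizer => //; last by exists s.
  by move=> r /mQ [].
by rewrite invr_eq0; apply/eqP => y0; apply: ny; rewrite y0; apply: subring0.
Qed.

(** If the prime of a generization misses [t], each of its elements is [a * t] with [a] in the same
    prime, hence divisible by all powers of [t] and so 0. If it contains [t], it is the maximal
    ideal of [x]. *)
Lemma uniformizer_codim1 x t : uniformizer x t -> t != 0 -> codim1 x.
Proof.
move=> [mt ht] t0; have hR := stalk_subring x; split.
  by move/genericP => /(_ _ mt) /eqP; rewrite (negPf t0).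
move=> y cl; have [V hV Vx] := affine_nbhd x.
have Vy : V y by move/closure1P: cl; apply=> //; apply: affine_open_open.
have [my|nmy] := pselect (max_ideal y t).
  left; apply: (affine_point_inj hV) => //.
  apply/seteqP; split=> s [Vs ms]; split=> //.
    by apply: closure_max_ideal cl _ ms; apply: (stalk_affine_sub hV Vx).
  have [a Ra ->] := ht s ms; apply: nonunits_mul => //; first exact: stalk_subring.
  exact: closure_stalk cl _ _.
right; apply/genericP; apply: (max_ideal_affine0 hV Vy) => s Vs ms.
apply: contrapT => /eqP s0.
have Rt : stalk x t by case: mt.
have ntV : ~ stalk x t^-1 by move=> h; case: mt => _; apply.
have [m] := noetherian_no_divisible hR (@stalk_noetherian x) Rt ntV s0; apply.
suff [] : stalk x (s / t ^+ m) /\ max_ideal y (s / t ^+ m) by [].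
elim: m => [|m [Rm mm]].
  by rewrite expr0 divr1; split=> //; apply: (stalk_affine_sub hV Vx).
have [a Ra ea] := ht _ (closure_max_ideal cl Rm mm).
have -> : s / t ^+ m.+1 = a.
  by rewrite exprS invfM mulrCA ea mulrCA mulVf // mulr1.
split=> //.
have Ya : stalk y a := closure_stalk cl Ra.
have Yt : stalk y t := closure_stalk cl Rt.
have : max_ideal y (a * t) by rewrite -ea.
by move/(nonunits_prime (stalk_subring y) Ya Yt) => [].
Qed.

(* Algebraic Hartogs: an associated prime of [z] modulo the local ring of [x]
   would be the maximal ideal of a point of codimension 1 at which [z] is not
   regular. *)
Lemma stalk_hartogs x z :
  (forall y, codim1 y -> closure [set y] x -> stalk y z) -> stalk x z.
Proof.
move=> hz; apply: contrapT => nz; have hR := stalk_subring x.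
have [c Rc hQ] := associated_prime hR (@stalk_noetherian x) nz.
set Q := (X in prime_ideal _ X) in hQ.
have [y [cl mQ Ry]] := stalk_prime hQ.
have clR := closure_stalk cl.
have hRy := stalk_subring y.
pose w := c * z.
have nw : ~ stalk y w.
  move=> /Ry [a [s [Ra Rs nQs s0 ew]]]; apply: nQs; split=> //.
  by rewrite -/w ew mulrC divfK.
have mw r : max_ideal y r -> stalk y (r * w).
  move=> mr; have [a [s [Ra Rs nQs s0 er]]] := Ry r (proj1 mr).
  have us : unit_of (stalk y) s.
    by apply/max_idealP; [exact: clR|move/(mQ _ Rs)].
  have [_ Qa] : Q a.
    apply/mQ => //; have -> : a = s * r by rewrite er mulrC divfK.
    by apply: nonunits_mul => //; apply: clR.
  rewrite er mulrAC; apply: subringM => //; first exact: clR.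
  by case: us.
(* A denominator of [z] provides the nonzero element of [max_ideal y] that [inverse_uniformizer]
   asks for. *)
have [a [s [Ra Rs s0 ez]]] := stalk_frac x z.
have ms : max_ideal y s.
  by apply/mQ => //; split=> //; rewrite mulrCA ez mulrC [s * _]mulrC divfK //; apply: subringM.
have ut : uniformizer y w^-1 by apply: inverse_uniformizer => //; exists s.
have w0 : w^-1 != 0.
  by rewrite invr_eq0; apply/eqP => w0; apply: nw; rewrite w0; apply: subring0.
have cy := uniformizer_codim1 ut w0.
by apply: nw; apply: subringM => //; [exact: clR|exact: hz].
Qed.

End Scheme.

(** * Orders of vanishing at points of codimension 1 *)

Section Orders.
Variables (k : fieldType) (X : ratspace k).
Hypothesis hX : normal_variety X.
Local Notation K := (funfield X).
Local Notation O := (@sections k X).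
Implicit Types (x y : X) (U V W : set X) (z s t u : K).

Lemma uniformizer_unit_exp x t (j : int) : uniformizer x t -> t != 0 ->
  unit_of (stalk x) (t ^ j) -> j = 0.
Proof.
move=> [[Rt nut] _] t0; have hR := stalk_subring hX x.
have nat_case m : ~ unit_of (stalk x) (t ^+ m.+1).
  by rewrite exprS => h; apply: nut; apply: unit_of_factor h => //; apply: subringX.
case: j => [[//|m]|m] h; first by case: (nat_case m).
by case: (nat_case m); have := unit_ofV h; rewrite invrK.
Qed.

(** Two uniformizers differ by a unit, so the exponent picked by [xget] does not depend on the
    decomposition. *)
Lemma ord_unit_exp x t u (m : int) : uniformizer x t -> t != 0 ->
  unit_of (stalk x) u -> ord x (u * t ^ m) = m.
Proof.
move=> ut t0 uu; have hR := stalk_subring hX x.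
apply: xget_unique; first by exists t, u.
move=> m' [t' [u' [ut' uu' e]]].
have [[Rt nut] ht] := ut; have [[Rt' nut'] ht'] := ut'.
have [a Ra ea] := ht _ (conj Rt' nut'); have [b Rb eb] := ht' _ (conj Rt nut).
have a0 : a != 0.
  by apply: contra_neq t0 => a0; rewrite eb ea a0 mul0r mulr0.
have ua : unit_of (stalk x) a.
  have ab1 : b * a = 1 by apply: (mulIf t0); rewrite mul1r -mulrA -ea -eb.
  by split=> //; rewrite -[a^-1]mul1r -ab1 mulfK.
suff /(uniformizer_unit_exp ut t0) : unit_of (stalk x) (t ^ (m' - m)) by lia.
have tm0 (j : int) : t ^ j != 0 by rewrite expfz_neq0.
have am0 (j : int) : a ^ j != 0 by rewrite expfz_neq0.
have [u0 _ _] := uu; have [u'0 _ _] := uu'.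
have -> : t ^ (m' - m) = u / (u' * a ^ m').
  apply: (mulIf (tm0 m)); rewrite -expfzDr // subrK.
  rewrite mulrAC e ea expfzMl mulrA mulrAC mulfV ?mul1r //.
  by rewrite mulf_neq0.
apply: unit_ofM => //; apply: unit_ofV.
by apply: unit_ofM => //; apply: unit_ofXz.
Qed.

Lemma ord_decomposition x z : codim1 x -> z != 0 -> exists t u,
  [/\ uniformizer x t, t != 0, unit_of (stalk x) u & z = u * t ^ ord x z].
Proof.
move=> cx z0; have [t ut t0] := codim1_uniformizer hX cx.
have [mt ht] := ut.
have [u [m [uu ez]]] := uniformizer_decomposition (stalk_subring hX x)
  (@stalk_noetherian _ _ hX x) mt t0 ht (stalk_frac hX x) z0.
by exists t, u; split=> //; rewrite [in ord _ _]ez ord_unit_exp.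
Qed.

Lemma ord_uniformizer x t : uniformizer x t -> t != 0 -> ord x t = 1.
Proof.
move=> ut t0; rewrite -[t in LHS]mul1r -[t in LHS]expr1z ord_unit_exp //.
exact/unit_of1/stalk_subring.
Qed.

Lemma ord_unit x u : codim1 x -> unit_of (stalk x) u -> ord x u = 0.
Proof.
move=> cx uu; have [t ut t0] := codim1_uniformizer hX cx.
by rewrite -[u]mulr1 -(expr0z t) ord_unit_exp.
Qed.

Lemma ordM x z s : codim1 x -> z != 0 -> s != 0 -> ord x (z * s) = ord x z + ord x s.
Proof.
move=> cx z0 s0; have hR := stalk_subring hX x.
have [t ut t0] := codim1_uniformizer hX cx.
have dec w : w != 0 -> exists u, unit_of (stalk x) u /\ w = u * t ^ ord x w.
  move=> w0; have [u [m [uu ew]]] := uniformizer_decomposition hR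
    (@stalk_noetherian _ _ hX x) (proj1 ut) t0 (proj2 ut) (stalk_frac hX x) w0.
  by exists u; split=> //; rewrite [in ord _ _]ew ord_unit_exp.
have [u [uu ez]] := dec _ z0; have [v [uv es]] := dec _ s0.
rewrite [in LHS]ez [in LHS]es mulrACA -expfzDr // ord_unit_exp //.
exact: unit_ofM.
Qed.

Lemma ord1 x : codim1 x -> ord x 1 = 0.
Proof. by move=> cx; apply: ord_unit => //; apply/unit_of1/stalk_subring. Qed.

Lemma ordX x z m : codim1 x -> z != 0 -> ord x (z ^+ m) = m%:Z * ord x z.
Proof.
move=> cx z0; elim: m => [|m IH]; first by rewrite expr0 ord1 // mul0r.
by rewrite exprS ordM ?expf_neq0 // IH -add1n PoszD mulrDl mul1r.
Qed.

Lemma stalk_ord x z : codim1 x -> z != 0 -> stalk x z <-> 0 <= ord x z.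
Proof.
move=> cx z0; have hR := stalk_subring hX x.
have [t [u [ut t0 uu ez]]] := ord_decomposition cx z0.
have [[Rt nut] _] := ut.
split=> [Rz|].
  rewrite leNgt; apply/negP; case em: (ord x z) => [|m] // _.
  apply: nut; rewrite em NegzE -exprnN in ez.
  have e : t * (t ^+ m * (z * u^-1)) = 1.
    have [u0 _ _] := uu; rewrite ez mulrA -exprS mulrAC mulfV // mul1r mulfV //.
    exact: expf_neq0.
  apply: (@unit_of_factor _ _ hR t (t ^+ m * (z * u^-1))) => //.
    apply: subringM; [exact: hR|exact: subringX|apply: subringM => //].
    by case: uu.
  by rewrite e; apply: unit_of1.
case em: (ord x z) => [m|] // _; rewrite ez em.
by apply: subringM => //; [case: uu|exact: (subringX hR)].
Qed.

Lemma max_ideal_ord x z : codim1 x -> z != 0 -> max_ideal x z <-> 0 < ord x z.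
Proof.
move=> cx z0; have hR := stalk_subring hX x.
have oV : ord x z^-1 = - ord x z.
  have := ordM cx z0 (_ : z^-1 != 0); rewrite mulfV // ord1 // invr_eq0 => /(_ z0).
  by move=> e; apply/eqP; rewrite -addr_eq0 addrC -e.
split=> [[/stalk_ord -/(_ cx z0) h nu]|h].
  rewrite lt_neqAle h andbT; apply/negP => /eqP e; apply: nu; split=> //.
    by apply/stalk_ord => //; rewrite -e.
  by apply/stalk_ord; rewrite ?invr_eq0 // oV -e oppr0.
split; first by apply/stalk_ord => //; apply: ltW.
move=> [_ _ /(stalk_ord cx)]; rewrite invr_eq0 oV => /(_ z0); lia.
Qed.

(** Finitely many generators of the prime of [y] stay divisible by [t] near [y]. Hence, where [t]
    vanishes at [y'], the point [y] is a generization of [y'], and codimension 1 leaves only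
    [y' = y]. *)
Lemma uniformizer_isolated y t : uniformizer y t -> t != 0 ->
  exists N, [/\ open N, N y &
    forall y', N y' -> codim1 y' -> max_ideal y' t -> y' = y].
Proof.
move=> ut t0; have [mt ht] := ut.
have [V [hV Vy nV]] := affine_noetherian_nbhd hX y.
have [g [gQ Qg]] := nV _ (prime_ideal_ideal (affine_prime hV Vy)).
have [|N [oN Ny hN]] := @stalk_common _ _ hX [seq a / t | a <- g] y.
  by move=> _ /mapP[a /gQ [_ /ht [b Rb ->]] ->]; rewrite mulfK.
exists (N `&` V); split=> //; first by apply: openI => //; apply: affine_open_open.
move=> y' [Ny' Vy'] [_ cy'] my'.
have [|//|e] := cy' y; last by case: (uniformizer_codim1 hX ut t0).
apply: (closure_affine hX hV) => //.
have gy' : O V `&` max_ideal y `<=` O V `&` max_ideal y'.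
  apply: Qg; first exact: prime_ideal_ideal (affine_prime hV Vy').
  move=> a ag; split; first by case: (gQ _ ag).
  rewrite -[a](divfK t0); apply: nonunits_mul => //; first exact: stalk_subring.
  by apply: stalk_sections Ny' _ _ => //; apply: hN; apply/mapP; exists a.
by move=> s /gy' [].
Qed.

Lemma sheaf_of_effective (D : X -> rat) U : nonempty_open U -> effective D ->
  O U `<=` sheaf_of D U.
Proof.
move=> hU eD z Oz; have [->|/eqP z0] := pselect (z = 0); first by left.
right=> x Ux cx; apply: addr_ge0; last by rewrite /round_down floor_ge0.
by apply/stalk_ord => //; apply: stalk_sections Oz => //; case: hU.
Qed.

Lemma witt_sheaf_of_effective p n (D : X -> rat) U : nonempty_open U -> effective D ->
  witt_structure_sheaf U `<=` @witt_sheaf_of _ X p n D U.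
Proof.
move=> hU eD v Ov i; apply: sheaf_of_effective (Ov i) => // x.
by rewrite mulr_ge0.
Qed.

End Orders.

(** * Traces in characteristic p *)

Lemma poly_expp (K : fieldType) p (hp : p \in [pchar K]) (q : {poly K}) :
  q ^+ p = map_poly (pFrobenius_aut hp) q \Po 'X^p.
Proof.
have hpP : p \in [pchar {poly K}] by rewrite pchar_poly.
elim/poly_ind: q => [|q c IH].
  by rewrite map_poly0 comp_poly0 expr0n; case: p hp {hpP} => // /pcharf_prime.
rewrite -[LHS](pFrobenius_autE hpP) rmorphD rmorphM /= !pFrobenius_autE.
rewrite rmorphD rmorphM /= map_polyX map_polyC /= comp_polyD comp_polyM comp_polyX comp_polyC.
by rewrite IH pFrobenius_autE polyC_exp.
Qed.

(** In characteristic [p], [(X - M)^p = X^p - M^p] because the scalar [X] commutes with [M].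
    Determinants then compare the characteristic polynomials of [M] and [M ^+ p]. *)
Lemma mxtrace_expp (K : fieldType) p (hp : p \in [pchar K]) n (M : 'M[K]_n.+1) :
  \tr (M ^+ p) = \tr M ^+ p.
Proof.
have p0 : (0 < p)%N by apply/prime_gt0/pcharf_prime/hp.
have hpM : p \in [pchar 'M[{poly K}]_n.+1].
  rewrite inE (pcharf_prime hp) /= -(rmorph_nat (@scalar_mx {poly K} n.+1)).
  have /andP[_ /eqP ->] : p \in [pchar {poly K}] by rewrite pchar_poly.
  by rewrite raddf0.
have e : char_poly M ^+ p = char_poly (M ^+ p) \Po 'X^p.
  have detX (N : 'M[{poly K}]_n.+1) m : \det (N ^+ m) = \det N ^+ m.
    by elim: m => [|m IH]; rewrite ?det1 // !exprS -IH det_mulmx.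
  rewrite /char_poly -detX -det_map_mx; congr (\det _).
  rewrite -[LHS](pFrobenius_autE hpM) pFrobenius_autB_comm; last first.
    by rewrite /GRing.comm -!mulmxE scalar_mxC.
  rewrite !pFrobenius_autE -!rmorphXn /=.
  apply/matrixP => i j; rewrite !mxE raddfB raddfMn /= comp_polyX comp_polyC.
  by [].
(* The matrices have size [n.+1], so the coefficient of degree [n] of a characteristic polynomial is
   minus the trace. *)
have := congr1 (fun q : {poly K} => q`_(n * p)) e.
rewrite /= (poly_expp hp) !coef_comp_poly_Xn // dvdn_mull // mulnK //.
rewrite coef_map /= -[n in _`_n]/(n.+1.-1) !char_poly_trace //.
rewrite pFrobenius_autE exprNn; case: (p =P 2%N) => [p2|/eqP p2].
  have n1 : -1 = 1 :> K.
    by apply/eqP; rewrite -subr_eq0 -opprD oppr_eq0; have /andP[_] := hp; rewrite p2.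
  by rewrite n1 expr1n mul1r -mulN1r n1 mul1r.
have op : odd p by have /even_prime[/eqP|] := pcharf_prime hp; rewrite ?(negPf p2).
by rewrite -signr_odd op expr1 mulN1r => /oppr_inj.
Qed.

(** [Tr y] is the trace of multiplication by [y] in the given basis. Coordinates are rows, so the
    matrices multiply in reverse order, which is harmless for powers. *)
Lemma field_degree_trace (K L : fieldType) (phi : {rmorphism K -> L}) d p :
  field_degree phi d -> (0 < d)%N -> p \in [pchar K] ->
  exists Tr : L -> K, [/\ forall y z, Tr (y + z) = Tr y + Tr z,
    forall a y, Tr (phi a * y) = a * Tr y, Tr 1 = d%:R &
    forall y, Tr (y ^+ p) = Tr y ^+ p].
Proof.
case: d => // d [b hb] _ hp.
have [co hco] := choice hb.
have coE y : y = \sum_i phi (co y i) * b i by case: (hco y).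
have coU y c : y = \sum_(i < d.+1) phi (c i) * b i -> forall i, co y i = c i.
  move=> e i; have [_ h] := hco y.
  rewrite (h (finfun c)) ?ffunE // [LHS]e; apply: eq_bigr => j _; by rewrite ffunE.
have coD y z i : co (y + z) i = co y i + co z i.
  apply: (coU _ (fun i => co y i + co z i)); rewrite [in LHS](coE y) [in LHS](coE z).
  by rewrite -big_split; apply: eq_bigr => j _; rewrite rmorphD mulrDl.
have coZ a y i : co (phi a * y) i = a * co y i.
  apply: (coU _ (fun i => a * co y i)); rewrite [in LHS](coE y) mulr_sumr.
  by apply: eq_bigr => j _; rewrite rmorphM mulrA.
have co_sum (I : finType) (F : I -> L) i : co (\sum_j F j) i = \sum_j co (F j) i.
  have co0 : co 0 i = 0 by have := coZ 0 0 i; rewrite mulr0 mul0r.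
  by elim/big_ind2: _ => // u v u' v' <- <-.
pose M y := (\matrix_(i, j) co (y * b i) j)%R : 'M[K]_d.+1.
have M1 : M 1 = 1.
  apply/matrixP => i j; rewrite !mxE mul1r.
  apply: (coU _ (fun j => (i == j)%:R)).
  rewrite (bigD1 i) //= eqxx rmorph1 mul1r big1 ?addr0 // => l.
  by rewrite eq_sym => /negPf ->; rewrite rmorph0 mul0r.
have MM y z : M (y * z) = M z * M y.
  apply/matrixP => i j; rewrite -mulmxE !mxE -mulrA [z * b i]coE mulr_sumr co_sum.
  by apply: eq_bigr => l _; rewrite !mxE mulrCA coZ.
have MX y m : M (y ^+ m) = M y ^+ m.
  elim: m => [|m IH]; first by rewrite !expr0 M1.
  by rewrite exprSr MM IH -exprS.
exists (fun y => \tr (M y)); split.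
- by move=> y z; rewrite -mxtraceD; congr (\tr _); apply/matrixP => i j; rewrite !mxE mulrDl coD.
- by move=> a y; rewrite -mxtraceZ; congr (\tr _); apply/matrixP => i j; rewrite !mxE -mulrA coZ.
- by rewrite M1 mxtrace1.
- by move=> y; rewrite MX mxtrace_expp.
Qed.

(** * Witt vectors *)

Lemma rmorph_mmap (n : nat) (R S : comNzRingType) (F : {rmorphism R -> S})
    (h : 'I_n -> R) (P : {mpoly int[n]}) :
  F (mmap intr h P) = mmap intr (fun l => F (h l)) P.
Proof.
rewrite /mmap rmorph_sum; apply: eq_bigr => m _.
rewrite rmorphM rmorph_int /mmap1 rmorph_prod; congr (_ * _).
by apply: eq_bigr => i _; rewrite rmorphXn.
Qed.

Lemma rmorph_ghost (p n : nat) (R S : comNzRingType) (F : {rmorphism R -> S})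
    (x : 'I_n -> R) i : F (ghost p x i) = ghost p (fun l => F (x l)) i.
Proof.
rewrite /ghost rmorph_sum; apply: eq_bigr => j _.
rewrite rmorphM rmorph_nat; congr (_ * _); exact: rmorphXn.
Qed.

Lemma eq_ghost (p n : nat) (R : nzRingType) (x y : 'I_n -> R) i :
  x =1 y -> ghost p x i = ghost p y i.
Proof. by move=> e; apply: eq_bigr => j _; rewrite e. Qed.

(** The ghost map is triangular with diagonal factors [p ^ i]. Since these must not vanish,
    identities are proved over [{mpoly int[n + n]}] and then specialized. *)
Lemma ghost_inj (p n : nat) (R : idomainType) (x y : 'I_n -> R) :
  (forall m, (p ^ m)%N%:R != 0 :> R) ->
  (forall i, ghost p x i = ghost p y i) -> x =1 y.
Proof.
move=> p0 e i; have [m] := ubnP (val i); elim: m i => // m IH i im.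
have := e i; rewrite /ghost (bigD1 i) //= [RHS](bigD1 i) //=.
rewrite (eq_bigr (fun j : 'I_n => (p ^ j)%N%:R * y j ^+ (p ^ (i - j)))); last first.
  move=> j /andP[ji nji]; rewrite IH //.
  by move: im ji nji; rewrite -val_eqE /=; lia.
move/addIr; rewrite subnn expn0 !expr1; exact: mulfI.
Qed.

Lemma mpoly_natr_neq0 (m c : nat) : (0 < c)%N -> c%:R != 0 :> {mpoly int[m]}.
Proof.
move=> c0; rewrite -(rmorph_nat (@mpolyC m int)) mpolyC_eq0.
by rewrite pnatr_eq0 -lt0n.
Qed.

Definition teichmuller (n : nat) (K : fieldType) (s : K) : n.-tuple K :=
  [tuple if (i : nat) == 0%N then s else 0 | i < n].

Lemma ghost_teichmuller (p n : nat) (R : nzRingType) (s : R) (i : 'I_n) : (0 < p)%N ->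
  ghost p (fun j : 'I_n => if (j : nat) == 0%N then s else 0) i = s ^+ (p ^ i).
Proof.
move=> p0; have n0 : (0 < n)%N by apply: leq_ltn_trans (ltn_ord i).
rewrite /ghost (bigD1 (Ordinal n0)) //= expn0 mul1r subn0 big1 ?addr0 //.
move=> j /andP[_]; rewrite -val_eqE /= => /negPf ->.
by rewrite expr0n expn_eq0 (gtn_eqF p0) /= mulr0.
Qed.

Lemma witt_mul_teichmuller (p n : nat) (K : fieldType) (s : K) (v : n.-tuple K) :
  (0 < p)%N -> (exists S : n.-tuple _, witt_polys p *%R S) ->
  witt_mul p (teichmuller n s) v = [tuple s ^+ (p ^ i) * tnth v i | i < n].
Proof.
move=> p0 hS; rewrite /witt_mul /witt_op; cbv zeta.
set S := xget _ _; have {hS} Sw : witt_polys p *%R S by apply: xgetPex; exact: hS.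
pose ab (l : 'I_(n + n)) := match split l with
  inl u => tnth (teichmuller n s) u | inr u => tnth v u end.
(* The universal Teichmuller vector: all left variables except the first become 0. *)
pose h (l : 'I_(n + n)) : {mpoly int[n + n]} :=
  if split l is inl u then (if (u : nat) == 0%N then 'X_l else 0) else 'X_l.
pose T := mmap intr h : {mpoly int[n + n]} -> {mpoly int[n + n]}.
(* [c i] is the index 0; [i] only witnesses that [n] is positive. *)
pose c (i : 'I_n) : 'I_n := Ordinal (leq_ltn_trans (leq0n i) (ltn_ord i)).
have mX (R : comNzRingType) (g : 'I_(n + n) -> R) l : mmap intr g 'X_l = g l.
  rewrite mmapX /mmap1 (bigD1 l) //= mnmE eqxx expr1 big1 ?mulr1 // => j jl.
  by rewrite mnmE eq_sym (negPf jl) expr0.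
have TX l : T 'X_l = h l by apply: mX.
have key i : T (tnth S i) = 'X_(lshift n (c i)) ^+ (p ^ i) * 'X_(rshift n i).
  apply: (@ghost_inj p n _ (fun i => T (tnth S i))
    (fun i => 'X_(lshift n (c i)) ^+ (p ^ i) * 'X_(rshift n i))).
    by move=> m; apply: mpoly_natr_neq0; rewrite expn_gt0 p0.
  move=> {}i; rewrite -[LHS]rmorph_ghost Sw rmorphM !rmorph_ghost.
  rewrite (@eq_ghost _ _ _ _ (fun j : 'I_n => if (j : nat) == 0%N then
     'X_(lshift n (c i)) else 0)); last first.
    move=> j; rewrite [LHS]TX /h; case: splitP => u /= e; last by have := ltn_ord j; lia.
    rewrite -e; case: eqP => // j0; congr 'X_(_).
    by apply: val_inj; rewrite /= j0.
  rewrite ghost_teichmuller // /ghost mulr_sumr; apply: eq_bigr => j ji.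
  rewrite [X in _ * (_ * X ^+ _)](TX (rshift n j)) /h; case: splitP => u /= e; first by have := ltn_ord u; lia.
  rewrite mulrCA exprMn -exprM -expnD subnKC //.
apply: eq_from_tnth => i; rewrite !tnth_mktuple -/ab.
(* [ab] vanishes wherever [h] puts 0, so the substitution [T] is invisible after specialization. *)
have <- : mmap intr ab (T (tnth S i)) = mmap intr ab (tnth S i).
  rewrite rmorph_mmap; congr (mmap _ _ _); apply/funext => l; rewrite /h.
  case: splitP => u e; last exact: mX.
  case: eqP => u0; first exact: mX.
  rewrite rmorph0 /ab; case: splitP => w e'; last by have := ltn_ord u; lia.
  by rewrite tnth_mktuple -e' e; case: eqP.
rewrite key rmorphM rmorphXn /= !mX /ab.
case: splitP => u /= e; last by have := ltn_ord (c i); lia.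
case: splitP => w /= e'; first by have := ltn_ord w; lia.
rewrite tnth_mktuple -e /=; congr (_ * tnth v _).
by apply: val_inj; move: e' => /=; lia.
Qed.

Lemma witt_op_rmorph (p n : nat) op (K L : fieldType) (phi : {rmorphism K -> L})
    (a b : n.-tuple K) :
  map_tuple phi (witt_op p op a b) = witt_op p op (map_tuple phi a) (map_tuple phi b).
Proof.
apply: eq_from_tnth => i; rewrite tnth_map !tnth_mktuple rmorph_mmap.
congr (mmap _ _ _); apply/funext => l.
by case: splitP => u _; rewrite tnth_map.
Qed.

Lemma witt_op_subring (p n : nat) op (K : fieldType) (A : set K) (a b : n.-tuple K) :
  subring A -> (forall i, A (tnth a i)) -> (forall i, A (tnth b i)) ->
  forall i, A (tnth (witt_op p op a b) i).
Proof.
move=> hA Aa Ab i; rewrite tnth_mktuple; pose S := SubringOf hA.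
suff : mmap intr (fun l : 'I_(n + n) => match split l with
    inl u => tnth a u | inr u => tnth b u end)
  (tnth (xget [tuple 0 | _ < n] [set S | witt_polys p op S]) i) \in mem_subring S.
  by move/subring_memP.
apply: rpred_sum => m _; apply: rpredM; first exact: rpred_int.
apply: rpred_prod => l _; apply: rpredX; apply/subring_memP.
by case: splitP => j _; [apply: Aa|apply: Ab].
Qed.

Lemma witt_frob_rmorph (p n : nat) (K L : fieldType) (phi : {rmorphism K -> L})
    (a : n.-tuple K) :
  map_tuple phi (witt_frob p a) = witt_frob p (map_tuple phi a).
Proof.
by apply: eq_from_tnth => i; rewrite tnth_map !tnth_mktuple tnth_map rmorphXn.
Qed.

Lemma witt_frob_teichmuller (p n : nat) (K : fieldType) (s : K) : (0 < p)%N ->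
  witt_frob p (teichmuller n s) = teichmuller n (s ^+ p).
Proof.
move=> p0; apply: eq_from_tnth => i; rewrite !tnth_mktuple.
by case: eqP => // _; rewrite expr0n gtn_eqF.
Qed.

(** * Splittings as maps on Witt vectors of the function field *)

Section GenericSplitting.
Variables (k : fieldType) (X : ratspace k).
Hypothesis hX : normal_variety X.
Variables (p n : nat) (D : X -> rat).
Local Notation K := (funfield X).
Local Notation O := (@sections k X).
Local Notation W := (@witt_sheaf_of k X p n).

Lemma funfield_common (l : seq K) : exists U, nonempty_open U /\ forall a, a \in l -> O U a.
Proof.
have [[[[ne _] _ _ _ hK] _ _] _] := hX.
elim: l => [|a l [U [hU lU]]]; first by exists [set: X]; split=> //; split=> //; apply: openT.
have [V hV Va] : (\bigcup_(V in @nonempty_open _ X) O V) a by rewrite hK.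
have hUV := irreducible_openI hX hU hV.
exists (U `&` V); split=> // b; rewrite inE => /orP[/eqP ->|/lU Ub].
  by apply: (sections_mono hX hV hUV) => //; apply: subIsetr.
by apply: (sections_mono hX hU hUV) => //; apply: subIsetl.
Qed.

Lemma witt_structure_mono U V v : nonempty_open U -> nonempty_open V -> V `<=` U ->
  @witt_structure_sheaf _ X n U v -> @witt_structure_sheaf _ X n V v.
Proof. by move=> hU hV VU h i; apply: (sections_mono hX hU hV VU); apply: h. Qed.

(* Every Witt vector over the function field is a section of the Witt
   structure sheaf over some nonempty open set, so an effective splitting is
   the same thing as one map on all Witt vectors of the function field. *)
Definition generic_splitting (beta : n.-tuple K -> K) : Prop :=
  [/\ forall U v, nonempty_open U -> W (fun x => p%:R * D x) U v -> O U (beta v),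
      forall v w, beta (witt_add p v w) = beta v + beta w,
      forall r v, beta (witt_mul p (witt_frob p r) v) = r`_0 * beta v
    & forall v, beta (witt_frob p v) = v`_0].

Lemma generic_splitting_quasi_F_split beta :
  generic_splitting beta -> quasi_F_split p n D.
Proof. by case=> h1 h2 h3 h4; exists (fun _ => beta); split. Qed.

(** [beta v] is [alpha] over a chosen open set on which [v] is regular. Nonempty open sets meet, so
    compatibility with restriction makes the value independent of the choice. *)
Lemma quasi_F_split_generic_splitting : effective D -> quasi_F_split p n D ->
  exists beta, generic_splitting beta.
Proof.
move=> eD [alpha [a1 a2 a3 a4 a5]].
have epD : effective (fun x => p%:R * D x) by move=> x; rewrite mulr_ge0.
have exV (v : n.-tuple K) : exists U, nonempty_open U /\ witt_structure_sheaf U v.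
  have [U [hU vU]] := funfield_common v.
  by exists U; split=> // i; apply: vU; apply: mem_tnth.
have [V hV] := choice exV.
pose beta v := alpha (V v) v.
have W_of U v : nonempty_open U -> witt_structure_sheaf U v ->
    W (fun x => p%:R * D x) U v.
  by move=> hU; apply: (witt_sheaf_of_effective hX p hU epD).
have betaE U v : nonempty_open U -> W (fun x => p%:R * D x) U v -> beta v = alpha U v.
  move=> hU Wv; have [hVv vV] := hV v.
  have hI := irreducible_openI hX hU hVv.
  rewrite /beta -(a2 (V v) (U `&` V v)) //; last exact: W_of.
  by rewrite -(a2 U (U `&` V v)).
have common (v w : n.-tuple K) : exists U,
    [/\ nonempty_open U, witt_structure_sheaf U v & witt_structure_sheaf U w].
  have [hv vV] := hV v; have [hw wV] := hV w.
  have hI := irreducible_openI hX hv hw.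
  exists (V v `&` V w); split=> //.
    by apply: witt_structure_mono vV.
  by apply: witt_structure_mono wV.
exists beta; split.
- by move=> U v hU Wv; rewrite (betaE U) //; apply: a1.
- move=> v w; have [U [hU vU wU]] := common v w.
  have sU : witt_structure_sheaf U (witt_add p v w).
    by move=> i; apply: witt_op_subring => //; apply: sections_subring.
  by rewrite !(betaE U) //; try (by apply: W_of); rewrite a3 //; apply: W_of.
- move=> r v; have [U [hU rU vU]] := common r v.
  have hO := sections_subring hX hU.
  have sU : witt_structure_sheaf U (witt_mul p (witt_frob p r) v).
    move=> i; apply: witt_op_subring => // j; rewrite tnth_mktuple.
    exact: subringX.
  by rewrite !(betaE U) //; try (by apply: W_of); rewrite a4 //; apply: W_of.
- move=> v; have [hU vU] := hV v; have hO := sections_subring hX hU.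
  have sU : witt_structure_sheaf (V v) (witt_frob p v).
    by move=> i; rewrite tnth_mktuple; apply: subringX.
  rewrite (betaE (V v)) //; last exact: W_of.
  by rewrite a5 //; apply: (witt_sheaf_of_effective hX p hU eD).
Qed.

(* Witt's theorem provides the polynomials defining multiplication, but their
   existence also follows from that of a splitting: without them [witt_mul]
   would be constantly [0], contradicting linearity. *)
Lemma generic_splitting_witt_polys beta : (0 < n)%N -> (0 < p)%N ->
  generic_splitting beta -> exists S : n.-tuple _, @witt_polys p n *%R S.
Proof.
move=> n0 p0 [_ _ b3 b4]; apply: contrapT => hn.
have mul0 (v w : n.-tuple K) : witt_mul p v w = [tuple 0 | _ < n].
  apply: eq_from_tnth => i; rewrite !tnth_mktuple.
  rewrite (_ : xget _ _ = [tuple 0 | _ < n]) ?tnth_mktuple ?raddf0 //.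
  by case: xgetP => // S _ hS; case: hn; exists S.
pose one := [tuple (1 : K) | _ < n]; pose zero := [tuple (0 : K) | _ < n].
have e0 (a : K) : [tuple a | _ < n]`_0 = a.
  by rewrite -(tnth_nth 0 _ (Ordinal n0)) tnth_mktuple.
have := b3 one (witt_frob p one); rewrite mul0 b4 /one e0 mul1r.
have := b3 zero (witt_frob p one); rewrite mul0 /zero e0 mul0r => ->.
by move/eqP; rewrite eq_sym oner_eq0.
Qed.

(** Linearity for the lift of [s], whose Frobenius is the lift of [s ^+ p]; hence the exponent
    [p ^ i.+1]. *)
Lemma generic_splitting_teichmuller beta s (v : n.-tuple K) :
  (0 < n)%N -> (0 < p)%N -> generic_splitting beta ->
  beta [tuple s ^+ (p ^ i.+1) * tnth v i | i < n] = s * beta v.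
Proof.
move=> n0 p0 hb; have hS := generic_splitting_witt_polys n0 p0 hb.
have [_ _ b3 _] := hb.
have := b3 (teichmuller n s) v.
rewrite witt_frob_teichmuller // witt_mul_teichmuller //.
rewrite -[_`_0](tnth_nth 0 _ (Ordinal n0)) tnth_mktuple /= => <-.
by congr beta; apply: eq_from_tnth => i; rewrite !tnth_mktuple -exprM expnS.
Qed.

End GenericSplitting.

(** * Finite morphisms *)

Section SchemeExtra.
Variables (k : fieldType) (X : ratspace k).
Hypothesis hX : normal_variety X.
Local Notation K := (funfield X).
Local Notation O := (@sections k X).

Lemma sections_of_stalks (U : set X) z : nonempty_open U ->
  (forall x, U x -> stalk x z) -> O U z.
Proof.
move=> hU hz; pose C := [set V : set X | [/\ nonempty_open V, V `<=` U & O V z]].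
have e : \bigcup_(V in C) V = U.
  apply/seteqP; split=> [x [V [_ VU _] Vx]|x Ux]; first exact: VU.
  have [V [oV Vx] Vz] := hz x Ux.
  have hV := nonempty_open_of oV Vx; have hUV := irreducible_openI hX hU hV.
  exists (U `&` V) => //; split=> //.
  by apply: (sections_mono hX hV hUV) Vz; apply: subIsetr.
rewrite -e (sections_glue hX); last by move=> V [].
  by move=> V [].
have [_ [x Ux]] := hU; have : (\bigcup_(V in C) V) x by rewrite e.
by case=> V CV _; exists V.
Qed.

Lemma affine_denominator (V : set X) (l : seq K) : affine_open V ->
  exists s, [/\ O V s, s != 0 & forall a, a \in l -> O V (s * a)].
Proof.
move=> hV; have hA := affine_subring hX hV.
elim: l => [|a l [s [Vs s0 hs]]].
  by exists 1; split=> //; [apply: subring1|apply: oner_neq0].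
have [b [t [Vb Vt t0 ea]]] := funfield_affine hX hV a.
exists (s * t); split; [exact: subringM|exact: mulf_neq0|].
move=> c; rewrite inE => /orP[/eqP ->|/hs Vc].
  by rewrite -mulrA ea [t * _]mulrC divfK //; apply: subringM.
by rewrite mulrAC; apply: subringM.
Qed.

Lemma ordXz (x : X) z (m : int) : codim1 x -> z != 0 -> ord x (z ^ m) = m * ord x z.
Proof.
move=> cx z0; have [t [u [ut t0 uu ez]]] := ord_decomposition hX cx z0.
rewrite [in LHS]ez expfzMl exprz_exp ord_unit_exp //; first by rewrite mulrC.
by apply: unit_ofXz => //; apply: stalk_subring.
Qed.

End SchemeExtra.

Section FiniteMorphism.
Variables (k : fieldType) (Y X : ratspace k).
Variables (f : Y -> X) (phi : {rmorphism funfield X -> funfield Y}).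
Hypothesis hX : normal_variety X.
Hypothesis hY : normal_variety Y.
Hypothesis hf : surjective_morphism f phi.
Hypothesis hfin : finite_morphism f phi.
Local Notation K := (funfield X).
Local Notation L := (funfield Y).
Local Notation OX := (@sections k X).
Local Notation OY := (@sections k Y).
Implicit Types (x : X) (y : Y) (U : set X).

Lemma preimage_open U : open U -> open (f @^-1` U).
Proof. by move=> oU; case: hf => /continuousP h _ _ _ _; apply: h. Qed.

Lemma stalk_pullback y s : stalk (f y) s -> stalk y (phi s).
Proof.
case=> U [oU Ufy] Us; exists (f @^-1` U); first by split=> //; apply: preimage_open.
by have [_ _ _ h _] := hf; apply: h => //; apply: nonempty_open_of Ufy.
Qed.

Lemma max_ideal_pullback y s : stalk (f y) s ->
  max_ideal y (phi s) <-> max_ideal (f y) s.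
Proof. by case: hf => _ _ _ _; apply. Qed.

Lemma unit_pullback y s : unit_of (stalk (f y)) s -> unit_of (stalk y) (phi s).
Proof.
move=> [s0 hs hsV]; split; rewrite ?fmorph_eq0 -?fmorphV //; exact: stalk_pullback.
Qed.

(** * Integrality, incomparability and fibres over an affine open set *)

Section OverAffine.
Variable U : set X.
Hypothesis hU : affine_open U.
Local Notation A := (OX U).
Local Notation B := (OY (f @^-1` U)).

Let hB : affine_open (f @^-1` U). Proof. by case: (hfin hU). Qed.
Let rA : subring A. Proof. exact: affine_subring. Qed.
Let rB : subring B. Proof. exact: affine_subring. Qed.

Lemma sections_pullback a : A a -> B (phi a).
Proof. by have [_ _ _ h _] := hf; apply: h; apply: affine_nonempty. Qed.

Lemma finite_integral z : B z ->
  exists q : {poly K}, [/\ q \is monic, forall i, A q`_i & root (map_poly phi q) z].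
Proof.
move=> Bz; have [_ [m [b [Bb hb]]]] := hfin hU.
have [c hc] := choice (fun i => hb _ (subringM rB Bz (Bb i))).
apply: (@det_trick _ _ phi A m b c) => //.
- apply: contrapT => hb0; have [e [_ e1]] := hb _ (subring1 rB).
  have /eqP := oner_neq0 L; apply; rewrite e1 big1 // => i _.
  suff -> : b i = 0 by rewrite mulr0.
  by apply: contrapT => /eqP bi0; apply: hb0; exists i.
- by move=> i j; case: (hc i).
- by move=> i; case: (hc i).
Qed.

(* Incomparability: the constant term of a monic relation for [u] modulo [Q']
   lies in [Q], hence in [Q'], so the relation can be divided by [u]. *)
Lemma finite_incomparable Q Q' : prime_ideal B Q -> prime_ideal B Q' ->
  Q' `<=` Q -> (forall a, A a -> Q (phi a) -> Q' (phi a)) -> Q `<=` Q'.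
Proof.
move=> hQ hQ' Q'Q hAQ u Qu; apply: contrapT => nQ'u.
have [QB _ QM _ _] := hQ; have [Q'B [Q'0 Q'D] Q'M Q'1 Q'p] := hQ'.
have Bu := QB _ Qu.
have [q [qm Aq rq]] := finite_integral Bu.
suff noq : forall q : {poly K}, q \is monic -> (forall i, A q`_i) ->
    ~ Q' (map_poly phi q).[u].
  by apply: (noq q) => //; rewrite (rootP rq).
move=> {qm Aq rq}; elim/poly_ind=> [|r c IH].
  by rewrite monicE lead_coef0 eq_sym oner_eq0.
move=> rm Ar Q'r.
have Ac : A c by have := Ar 0%N; rewrite coefD coefMX coefC /= add0r.
have Arr i : A r`_i.
  by have := Ar i.+1; rewrite coefD coefMX coefC /= addr0.
have er : (map_poly phi (r * 'X + c%:P)).[u] = (map_poly phi r).[u] * u + phi c.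
  by rewrite rmorphD rmorphM /= map_polyX map_polyC !hornerE.
have Br : B (map_poly phi r).[u].
  rewrite horner_coef; elim/big_ind: _ => [|a b|i _]; first exact: subring0.
    exact: subringD.
  rewrite coef_map /=; apply: subringM => //; first exact: sections_pullback.
  exact: subringX.
have [r0|/eqP r0] := pselect (r = 0).
  apply: Q'1; move: Q'r; rewrite er r0 map_poly0 horner0 mul0r add0r.
  by move: rm; rewrite r0 mul0r add0r monicE lead_coefC => /eqP ->; rewrite rmorph1.
have rm' : r \is monic.
  move: rm; rewrite !monicE lead_coefDl ?lead_coefMX //.
  rewrite size_mulX // ltnS; apply: leq_trans (size_polyC_leq1 _) _.
  by rewrite lt0n size_poly_eq0.
have iQ := prime_ideal_ideal hQ; have iQ' := prime_ideal_ideal hQ'.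
have Q'c : Q' (phi c).
  apply: hAQ => //; have -> : phi c = (map_poly phi (r * 'X + c%:P)).[u] -
      (map_poly phi r).[u] * u by rewrite er addrAC subrr add0r.
  by apply: (idealB rB iQ); [exact: Q'Q|exact: QM].
have : Q' ((map_poly phi r).[u] * u).
  have -> : (map_poly phi r).[u] * u =
    (map_poly phi (r * 'X + c%:P)).[u] - phi c by rewrite er addrK.
  exact: (idealB rB iQ').
by case/(Q'p _ _ Br Bu) => // /(IH rm' Arr).
Qed.

Let zero_prime : prime_ideal B [set 0].
Proof.
split.
- by move=> _ ->; apply: subring0.
- by split=> // a b -> ->; rewrite addr0.
- by move=> a _ _ ->; rewrite /= mulr0.
- by move/eqP; rewrite oner_eq0.
- by move=> a b _ _ /eqP; rewrite mulf_eq0 => /orP[] /eqP; [left|right].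
Qed.

(** Incomparability with the zero ideal, since both primes contract to 0. *)
Lemma finite_over_generic y : U (f y) -> max_ideal (f y) `<=` [set 0] ->
  B `&` max_ideal y `<=` [set 0].
Proof.
move=> Ufy hfy; apply: finite_incomparable => //.
- exact: (affine_prime hB).
- by move=> _ ->; split; [apply: subring0|apply: max_ideal0].
- move=> a Aa [_ ma]; have /hfy -> : max_ideal (f y) a; last by rewrite rmorph0.
  by apply/max_ideal_pullback => //; apply: (stalk_affine_sub hU).
Qed.

(* An ideal that is maximal among those containing [J] and missing [A \ m_x] is
   prime, so it is the ideal of a point lying over [x], since [x] has
   codimension 1 and [J] is nonzero. *)
Lemma finite_fiber_ideal x J : codim1 x -> U x -> ideal B J ->
  (exists2 s, J s & s != 0) ->
  (forall y, f y = x -> exists2 s, J s & ~ max_ideal y s) ->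
  exists a, [/\ A a, ~ max_ideal x a & J (phi a)].
Proof.
move=> cx Ux hJ [s0 Js0 s0n0] hy; apply: contrapT => hn.
have AR := stalk_affine_sub hU Ux.
pose good S := [/\ ideal B S, J `<=` S & forall a, A a -> S (phi a) -> max_ideal x a].
have gJ : good J.
  split=> // a Aa Ja; apply: contrapT => ma; apply: hn; by exists a.
(* The empty chain has union [set0], which is not an ideal; hence the extra alternative. *)
have [|M [PM Mmax]] := @Zorn_bigcup _ [set S | S = set0 \/ good S].
  move=> F FP tF.
  have [[S0 FS0 S0n]|allE] := pselect (exists2 S, F S & S <> set0); last first.
    left; apply/seteqP; split=> // z [S FS Sz].
    by have [|e] := pselect (S = set0) => [e|]; [rewrite e in Sz|case: allE; exists S].
  have gS S z : F S -> S z -> good S by move=> /FP [->//|].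
  have gS0 : good S0 by case: (FP _ FS0).
  right; split.
  - split.
    + by move=> z [S FS Sz]; have [[h _ _ _] _ _] := gS _ _ FS Sz; apply: h.
    + by exists S0 => //; have [[_ h _ _] _ _] := gS0.
    + move=> a b [S FS Sa] [S' FS' S'b].
      have [SS'|S'S] := tF _ _ FS FS'.
        have [[_ _ h _] _ _] := gS _ _ FS' S'b; exists S' => //; apply: h => //.
        exact: SS'.
      have [[_ _ h _] _ _] := gS _ _ FS Sa; exists S => //; apply: h => //.
      exact: S'S.
    + move=> a b Ba [S FS Sb]; have [[_ _ _ h] _ _] := gS _ _ FS Sb.
      by exists S => //; apply: h.
  - by move=> z Jz; exists S0 => //; have [_ h _] := gS0; apply: h.
  - by move=> a Aa [S FS Sa]; have [_ _ h] := gS _ _ FS Sa; apply: h.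
have gM : good M.
  case: PM => // M0; case: (Mmax J); last by right.
  by rewrite M0; split=> // /(_ _ Js0).
have [iM JM hM] := gM; have [MB M0 MD MM] := iM.
(* By maximality, [M + a B] meets the image of the complement of [max_ideal x] in [A]. *)
have enlarge a : B a -> ~ M a -> exists c m e,
    [/\ A c, ~ max_ideal x c, M m, B e & phi c = m + a * e].
  move=> Ba nMa; apply: contrapT => hno.
  pose M' := [set z | exists m e, [/\ M m, B e & z = m + a * e]].
  apply: (Mmax M').
    split; last first.
      move=> /(_ a) h; apply: nMa; apply: h; exists 0, 1.
      by split=> //; [apply: subring1|rewrite mulr1 add0r].
    move=> m Mm; exists m, 0; split=> //; first exact: subring0.
    by rewrite mulr0 addr0.
  right; split.
  - split.
    + move=> _ [m [e [Mm Be ->]]]; apply: subringD => //; first exact: MB.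
      exact: subringM.
    + by exists 0, 0; split=> //; [apply: subring0|rewrite mulr0 addr0].
    + move=> _ _ [m [e [Mm Be ->]]] [m' [e' [Mm' Be' ->]]].
      exists (m + m'), (e + e'); split; [exact: MD|exact: subringD|].
      by rewrite mulrDr addrACA.
    + move=> c _ Bc [m [e [Mm Be ->]]]; exists (c * m), (c * e).
      split; [exact: MM|exact: subringM|].
      by rewrite mulrDr mulrCA.
  - move=> z /JM Mz; exists z, 0; split=> //; first exact: subring0.
    by rewrite mulr0 addr0.
  - move=> c Ac [m [e [Mm Be ec]]]; apply: contrapT => mc; apply: hno.
    by exists c, m, e.
have pM : prime_ideal B M.
  split=> //.
    rewrite -(rmorph1 phi) => /hM -/(_ (subring1 rA)) [_]; apply.
    exact/unit_of1/stalk_subring.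
  move=> a b Ba Bb Mab; apply: contrapT => /not_orP [nMa nMb].
  have [c [m [e [Ac mc Mm Be ec]]]] := enlarge a Ba nMa.
  have [c' [m' [e' [Ac' mc' Mm' Be' ec']]]] := enlarge b Bb nMb.
  have : max_ideal x (c * c').
    apply: hM; first exact: subringM.
    have -> : phi (c * c') = (m' + b * e') * m + a * e * m' + e * e' * (a * b).
      by rewrite rmorphM ec ec'; ring.
    apply: (MD); first apply: (MD).
    - by apply: MM => //; apply: subringD; [|exact: MB|exact: subringM].
    - by apply: MM => //; apply: subringM.
    - by apply: MM => //; apply: subringM.
  have [_ _ _ _ h] := max_ideal_prime hX x.
  by case/(h _ _ (AR _ Ac) (AR _ Ac')).
have [y Ufy ey] := affine_point hB pM.
have cl : closure [set f y] x.
  apply: (closure_affine hX hU) => // a [Aa ma]; apply: hM => //.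
  suff : (B `&` max_ideal y) (phi a) by rewrite ey.
  split; first exact: sections_pullback.
  by apply/max_ideal_pullback => //; case: ma.
have [_ cx'] := cx; have [fyx|/(genericP hX) gen] := cx' _ cl.
  have [s Js ms] := hy y fyx; apply: ms.
  by have [] : (B `&` max_ideal y) s by rewrite ey; apply: JM.
have := @finite_over_generic y Ufy gen s0; rewrite ey => /(_ (JM _ Js0)).
by move/eqP: s0n0.
Qed.

(** A common denominator for the traces of finitely many module generators serves for the whole
    algebra. *)
Lemma trace_denominator (Tr : L -> K) :
  (forall u v, Tr (u + v) = Tr u + Tr v) -> (forall a u, Tr (phi a * u) = a * Tr u) ->
  exists s, [/\ A s, s != 0 & forall z, B z -> A (s * Tr z)].
Proof.
move=> TrD TrZ; have [_ [m [b [Bb hb]]]] := hfin hU.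
have [s [As s0 hs]] := affine_denominator hX [seq Tr (b i) | i <- enum 'I_m] hU.
exists s; split=> // z Bz; have [c [Ac ->]] := hb z Bz.
have Tr0 : Tr 0 = 0 by rewrite -[X in Tr X](mulr0 (phi 0)) TrZ mul0r.
rewrite (big_morph Tr TrD Tr0) mulr_sumr.
elim/big_ind: _ => [|u v|i _]; first exact: subring0.
  exact: subringD.
rewrite TrZ mulrCA; apply: subringM => //; apply: hs.
by apply/mapP; exists i; rewrite ?mem_enum.
Qed.

End OverAffine.

(** A generization of [y] maps to [f y] or to the generic point of [X]; by incomparability it is [y]
    in the first case and the generic point of [Y] in the second. *)
Lemma codim1_over y : codim1 (f y) -> codim1 y.
Proof.
move=> cx; have [s ms sn0] := codim1_max_ideal_neq0 hX cx.
have mphi : max_ideal y (phi s) by apply/max_ideal_pullback; case: ms.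
split.
  by move/(genericP hY) => /(_ _ mphi) /eqP; rewrite fmorph_eq0 (negPf sn0).
move=> y' cl; have [U hU Ufy] := affine_nbhd hX (f y).
have hB : affine_open (f @^-1` U) by case: (hfin hU).
have Ufy' : (f @^-1` U) y'.
  by move/closure1P: cl; apply=> //; apply: preimage_open; apply: affine_open_open.
have clf : closure [set f y'] (f y).
  by apply/closure1P => N oN Nfy; move/closure1P: cl => /(_ _ (preimage_open oN)); apply.
have [_ cx'] := cx; have [e|/(genericP hX) gen] := cx' _ clf.
  left; apply: (affine_point_inj hB) => //; apply/seteqP; split.
    move=> u [Bu mu]; split=> //; apply: closure_max_ideal cl _ mu.
    exact: (stalk_affine_sub hB).
  apply: (finite_incomparable hU); [exact: affine_prime|exact: affine_prime| |].
    move=> u [Bu mu]; split=> //; apply: closure_max_ideal cl _ mu.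
    exact: (stalk_affine_sub hB).
  move=> a Aa [Ba ma]; split=> //; apply/max_ideal_pullback.
    exact: (stalk_affine_sub hU).
  by rewrite e; apply/max_ideal_pullback => //; exact: (stalk_affine_sub hU).
right; apply/(genericP hY); apply: (max_ideal_affine0 hY hB) => // s' Bs' ms'.
exact: (finite_over_generic hU Ufy' gen (conj Bs' ms')).
Qed.

(** * Ramification indices *)

Section Ramification.
Variable y : Y.
Hypothesis cx : codim1 (f y).
Let cy : codim1 y := codim1_over cx.

Lemma ord_pullback_uniformizer t z : uniformizer (f y) t -> t != 0 -> z != 0 ->
  ord y (phi z) = ord (f y) z * ord y (phi t).
Proof.
move=> ut t0 z0.
have [u [m [uu ez]]] := uniformizer_decomposition (stalk_subring hX (f y))
  (@stalk_noetherian _ _ hX _) (proj1 ut) t0 (proj2 ut) (stalk_frac hX _) z0.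
have [u0 _ _] := uu.
rewrite ez ord_unit_exp // rmorphM ordM ?fmorph_eq0 //; last exact: expfz_neq0.
rewrite ord_unit //; last exact: unit_pullback.
by rewrite add0r fmorphXz ordXz // fmorph_eq0.
Qed.

Lemma ramification_indexE t : uniformizer (f y) t -> t != 0 ->
  ramification_index f phi y = ord y (phi t).
Proof.
move=> ut t0; apply: xget_unique; first by exists t.
move=> m [t' ut' ->].
have t'0 : t' != 0.
  apply: contra_neq t0 => t'0; have [a _ ->] := proj2 ut' t (proj1 ut).
  by rewrite t'0 mulr0.
by rewrite (ord_pullback_uniformizer ut t0 t'0) (ord_uniformizer hX ut' t'0) mul1r.
Qed.

Lemma ord_pullback z : z != 0 ->
  ord y (phi z) = ord (f y) z * ramification_index f phi y.
Proof.
move=> z0; have [t ut t0] := codim1_uniformizer hX cx.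
by rewrite (ramification_indexE ut t0) (ord_pullback_uniformizer ut).
Qed.

Lemma ramification_index_gt0 : 0 < ramification_index f phi y.
Proof.
have [t ut t0] := codim1_uniformizer hX cx.
rewrite (ramification_indexE ut t0); apply/(max_ideal_ord hY cy).
  by rewrite fmorph_eq0.
by apply/max_ideal_pullback; case: ut => [[]].
Qed.

End Ramification.

(** * Traces of functions vanishing on a fibre *)

Section Trace.
Variables (p : nat) (Tr : L -> K).
Hypothesis p_gt1 : (1 < p)%N.
Hypothesis TrD : forall u v, Tr (u + v) = Tr u + Tr v.
Hypothesis TrZ : forall a u, Tr (phi a * u) = a * Tr u.
Hypothesis Trp : forall u, Tr (u ^+ p) = Tr u ^+ p.

(* If [c := b z^(p^M) / t] is integral near [x], then the [Tr (c^(p^j))] have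
   bounded denominators, while [Tr (c^(p^j)) = (b / t)^(p^j) Tr(z)^(p^(M+j))];
   letting [j] grow bounds the order of [Tr z] below by a positive number. *)
Lemma max_ideal_trace x z : codim1 x ->
  (forall y, f y = x -> max_ideal y z) -> max_ideal x (Tr z).
Proof.
move=> cx hz; have hR := stalk_subring hX x.
have [U hU Ux] := affine_nbhd hX x.
have AR := stalk_affine_sub hU Ux.
have hB : affine_open (f @^-1` U) by case: (hfin hU).
have rA := affine_subring hX hU; have rB := affine_subring hY hB.
have Usub y : f y = x -> (f @^-1` U) y by move=> e; rewrite /= e.
have unit0 a : OX U a -> ~ max_ideal x a -> a != 0 /\ ord x a = 0.
  move=> Aa ma; have ua : unit_of (stalk x) a by apply/(max_idealP (AR _ Aa)).
  by split; [case: ua|apply: ord_unit].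
(* The denominators of [z] form an ideal contained in no prime over [x], so it contains some [phi a]
   with [a] a unit at [x]; this replaces [z] by a function regular on the whole preimage. *)
have [a [Aa ma Ba]] : exists a, [/\ OX U a, ~ max_ideal x a &
    OY (f @^-1` U) (phi a * z)].
  have [] := @finite_fiber_ideal U hU x
    [set s | OY (f @^-1` U) s /\ OY (f @^-1` U) (s * z)] cx Ux.
  - exact: ideal_denominators.
  - have [u [s [Bu Bs s0 ez]]] := funfield_affine hY hB z.
    by exists s => //; split=> //; rewrite ez mulrC divfK.
  - move=> y e; have [u [s [Bu Bs ms s0 ez]]] :=
      stalk_affine hY hB (Usub _ e) (proj1 (hz y e)).
    by exists s => //; split=> //; rewrite ez mulrC divfK.
  by move=> a [Aa ma [_ Ba]]; exists a.
have [a0 oa] := unit0 _ Aa ma.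
set z' := phi a * z in Ba.
have mz' y : f y = x -> max_ideal y z'.
  move=> e; apply: nonunits_mul; [exact: stalk_subring| |exact: hz].
  by apply: (stalk_affine_sub hB (Usub _ e)); apply: sections_pullback.
suff : max_ideal x (Tr z').
  rewrite /z' TrZ => h; have [_ Ra RaV] : unit_of (stalk x) a.
    by apply/(max_idealP (AR _ Aa)).
  by rewrite -[Tr z](mulKf a0); apply: nonunits_mul.
have [t [At mt t0]] : exists t, [/\ OX U t, max_ideal x t & t != 0].
  have [s ms s0] := codim1_max_ideal_neq0 hX cx.
  have [b [u [Ab Au mu u0 es]]] := stalk_affine hX hU Ux (proj1 ms).
  exists b; split=> //.
    rewrite -[b](divfK u0) -es mulrC; apply: nonunits_mul => //; exact: AR.
  by apply: contra_neq s0 => b0; rewrite es b0 mul0r.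
(* Each point over [x] has its own exponent making [z' ^+ N / phi t] regular there. Leaving [N]
   unspecified in the ideal yields one exponent for all of them. *)
have [b [Ab mb [Bb [N BN]]]] : exists b, [/\ OX U b, ~ max_ideal x b &
    OY (f @^-1` U) (phi b) /\ exists N, OY (f @^-1` U) (phi b * (z' ^+ N / phi t))].
  apply: (@finite_fiber_ideal U hU x [set s | OY (f @^-1` U) s /\
    exists N, OY (f @^-1` U) (s * (z' ^+ N / phi t))] cx Ux).
  - split.
    + by move=> s [].
    + by split; [exact: subring0|exists 0%N; rewrite mul0r; exact: subring0].
    + move=> s s' [Bs [N BN]] [Bs' [N' BN']]; split; first exact: subringD.
      exists (N + N')%N; rewrite exprD.
      have -> : (s + s') * (z' ^+ N * z' ^+ N' / phi t) =
        z' ^+ N' * (s * (z' ^+ N / phi t)) + z' ^+ N * (s' * (z' ^+ N' / phi t)) by ring.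
      by apply: subringD => //; apply: subringM => //; apply: subringX.
    + move=> s s' Bs [Bs' [N BN]]; split; first exact: subringM.
      by exists N; rewrite -mulrA; apply: subringM.
  - exists (phi t); last by rewrite fmorph_eq0.
    split; first exact: sections_pullback.
    by exists 0%N; rewrite expr0 mulrCA mulfV ?fmorph_eq0 // mulr1; apply: subring1.
  - move=> y e; have cfy : codim1 (f y) by rewrite e.
    have cy := codim1_over cfy.
    suff [N hN] : exists N, stalk y (z' ^+ N / phi t).
      have [u [s [Bu Bs ms s0 ez]]] := stalk_affine hY hB (Usub _ e) hN.
      by exists s => //; split=> //; exists N; rewrite ez mulrC divfK.
    have [z0|/eqP z0] := pselect (z' = 0).
      by exists 1%N; rewrite z0 expr1 mul0r; apply: subring0; apply: stalk_subring.
    have pt0 : phi t != 0 by rewrite fmorph_eq0.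
    (* [z'] has order at least 1 at [y], so this power has at least the order of [phi t]. *)
    exists `|ord y (phi t)|%N; apply/(stalk_ord hY cy).
      by rewrite mulf_neq0 ?invr_eq0 ?expf_neq0.
    have oz : 0 < ord y z' by apply/(max_ideal_ord hY cy) => //; apply: mz'.
    rewrite ordM ?invr_eq0 ?expf_neq0 // ordX // -exprN1 ordXz //.
    have : 0 < ord y (phi t).
      by apply/(max_ideal_ord hY cy) => //; apply/max_ideal_pullback; rewrite e //; case: mt.
    by move: oz; move: (ord y z') (ord y (phi t)) => u w; nia.
have [b0 ob] := unit0 _ Ab mb.
(* Raising the exponent from [N] to [p ^ N >= N] keeps integrality and makes [Trp] applicable. *)
pose c := phi b * (z' ^+ (p ^ N) / phi t).
have Bc : OY (f @^-1` U) c.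
  have -> : c = z' ^+ (p ^ N - N) * (phi b * (z' ^+ N / phi t)).
    by rewrite /c -[(p ^ N)%N in LHS](@subnK N) ?exprD; [ring|apply/ltnW/ltn_expl].
  by apply: subringM => //; apply: subringX.
have TrX w j : Tr (w ^+ (p ^ j)) = Tr w ^+ (p ^ j).
  elim: j => [|j IH]; first by rewrite expn0 !expr1.
  by rewrite expnSr exprM Trp IH -exprM.
have [s [As s0 hs]] := trace_denominator hU TrD TrZ.
have key j : OX U (s * ((b / t) ^+ (p ^ j) * Tr z' ^+ (p ^ (N + j)))).
  have -> : (b / t) ^+ (p ^ j) * Tr z' ^+ (p ^ (N + j)) = Tr (c ^+ (p ^ j)).
    have -> : c ^+ (p ^ j) = phi ((b / t) ^+ (p ^ j)) * z' ^+ (p ^ (N + j)).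
      by rewrite rmorphXn rmorphM fmorphV expnD exprM -exprMn /c mulrA mulrAC.
    by rewrite TrZ TrX.
  by apply: hs; apply: subringX.
have [w0|/eqP w0] := pselect (Tr z' = 0); first by rewrite w0; apply: max_ideal0.
apply/(max_ideal_ord hX cx) => //.
have ot : 0 < ord x t by apply/(max_ideal_ord hX cx).
have bt0 : b / t != 0 by rewrite mulf_neq0 ?invr_eq0.
have obt : ord x (b / t) = - ord x t.
  by rewrite ordM ?invr_eq0 // -exprN1 ordXz // ob; lia.
have bound j : 0 <= ord x s + (p ^ j)%:Z * (- ord x t + (p ^ N)%:Z * ord x (Tr z')).
  have /AR/(stalk_ord hX cx) := key j.
  have nz : (b / t) ^+ (p ^ j) * Tr z' ^+ (p ^ (N + j)) != 0.
    by rewrite mulf_neq0 ?expf_neq0.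
  rewrite mulf_neq0 // => /(_ isT).
  rewrite ordM // ordM ?expf_neq0 // !ordX // obt expnD PoszM.
  by move=> h; apply: le_trans h _; rewrite le_eqVlt; apply/orP; left; apply/eqP; ring.
rewrite ltNge; apply/negP => ow.
(* For this [j], [p ^ j] exceeds [ord x s], whereas the bracket in [bound] would be at most [-1] if
   [Tr z'] had order at most 0. *)
have := bound `|ord x s|%N.+1.
have := ltn_expl `|ord x s|%N.+1 p_gt1.
have : 0 <= (p ^ N)%:Z by [].
move: (p ^ `|ord x s|.+1)%N (ord x s) (ord x t) (ord x (Tr z')) (p ^ N)%:Z ot ow => P os ot ow Q.
move=> ot0 ow0 Q0 hP.
have h1 : - ot + Q * ow <= -1 by nia.
by nia.
Qed.

End Trace.

End FiniteMorphism.

(** * Descent of the splitting *)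

Section Descent.
Variables (p n : nat) (k : fieldType) (Y X : ratspace k).
Variables (f : Y -> X) (phi : {rmorphism funfield X -> funfield Y}).
Hypothesis p_gt1 : (1 < p)%N.
Hypothesis n_gt0 : (0 < n)%N.
Hypothesis hX : normal_variety X.
Hypothesis hY : normal_variety Y.
Hypothesis hf : surjective_morphism f phi.
Hypothesis hfin : finite_morphism f phi.
Variables (Delta : X -> rat) (DeltaY : Y -> rat).
Hypothesis Delta_floor : forall x, round_down Delta x = 0.
Hypothesis DeltaY_eff : effective DeltaY.
Hypothesis integral_diff : forall y, codim1 (f y) ->
  exists g : int, (ramification_index f phi y)%:~R * Delta (f y) - DeltaY y = g%:~R.
Variable beta : n.-tuple (funfield Y) -> funfield Y.
Hypothesis hbeta : generic_splitting p DeltaY beta.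

Local Notation e := (ramification_index f phi).

(* The pullback of a section of [W_n O_X(p Delta)], multiplied by the
   Teichmuller lift of [t^(p (e - 1))], is a section of [W_n O_Y(p DeltaY)]
   near [y]: the integer [e Delta - DeltaY] is less than [e]. *)
Lemma descent_local (U : set X) v y t : open U -> U (f y) -> codim1 (f y) ->
  uniformizer y t -> t != 0 ->
  @witt_sheaf_of _ X p n (fun x => p%:R * Delta x) U v ->
  stalk y (t ^+ `|e y - 1| * beta (map_tuple phi v)).
Proof.
move=> oU Ufy cx ut t0 Wv.
have cy := codim1_over hX hY hf hfin cx.
have e0 := ramification_index_gt0 hX hY hf hfin cx.
have [b1 _ _ _] := hbeta.
pose s := t ^+ `|e y - 1|.
pose w := [tuple s ^+ (p ^ i.+1) * tnth (map_tuple phi v) i | i < n].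
have p0 : (0 < p)%N by apply: ltnW.
rewrite -/s -(generic_splitting_teichmuller s _ n_gt0 p0 hbeta) -/w.
have hu (i : 'I_n) : exists u, tnth v i != 0 -> unit_of (stalk y) u /\
    phi (tnth v i) = u * t ^ (e y * ord (f y) (tnth v i)).
  have [vi0|vi0] := eqVneq (tnth v i) 0; first by exists 0.
  have pv0 : phi (tnth v i) != 0 by rewrite fmorph_eq0.
  have [u [m [uu ez]]] := uniformizer_decomposition (stalk_subring hY y)
    (@stalk_noetherian _ _ hY y) (proj1 ut) t0 (proj2 ut) (stalk_frac hY y) pv0.
  exists u => _; split=> //; rewrite ez; congr (_ * t ^ _).
  by rewrite -(ord_unit_exp hY m ut t0 uu) -ez (ord_pullback hX hY hf hfin cx vi0) mulrC.
have [u hu'] := choice hu.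
(* On [V0] both [t] and the unit parts [u i] are regular; on [N] below, [t] vanishes in codimension
   1 only at [y]. *)
have [|V0 [oV0 V0y hV0]] := @stalk_common _ _ hY
    (t :: [seq u i | i <- enum 'I_n & tnth v i != 0]) y.
  move=> a; rewrite inE => /orP[/eqP ->|]; first by case: ut => [[]].
  by case/mapP => i; rewrite mem_filter => /andP[/hu' [[_ h _] _] _] ->.
have [N [oN Ny hN]] := uniformizer_isolated hY ut t0.
have hV : nonempty_open (V0 `&` N).
  by apply: (@nonempty_open_of _ _ _ y) => //; apply: openI.
suff Ww : @witt_sheaf_of _ Y p n (fun y => p%:R * DeltaY y) (V0 `&` N) w.
  by exists (V0 `&` N); [split=> //; case: hV|apply: b1].
move=> i; rewrite tnth_mktuple tnth_map.
have [vi0|vi0] := eqVneq (tnth v i) 0; first by left; rewrite vi0 rmorph0 mulr0.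
right=> y' [V0y' Ny'] cy'.
have [[un0 _ _] pv] := hu' i vi0.
have Ru : stalk y' (u i).
  exists V0 => //; apply: hV0; rewrite inE; apply/orP; right.
  by apply/mapP; exists i => //; rewrite mem_filter vi0 mem_enum.
have Rt : stalk y' t by exists V0 => //; apply: hV0; rewrite mem_head.
have s0 : s != 0 by rewrite expf_neq0.
have pv0 : phi (tnth v i) != 0 by rewrite fmorph_eq0.
rewrite ordM ?expf_neq0 // ordX // ordX //.
(* Where [t] is a unit, each nonzero component of [w] has the order of its [u i], which is
   nonnegative. *)
have [mt|mt] := pselect (max_ideal y' t); last first.
  have ot : ord y' t = 0 by apply: ord_unit => //; apply/(max_idealP Rt).
  rewrite ot !mulr0 add0r pv ordM ?expfz_neq0 // ordXz // ot mulr0 addr0.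
  apply: addr_ge0; first exact/(stalk_ord hY cy' un0).
  by rewrite /round_down floor_ge0 !mulr_ge0.
have ey := hN _ Ny' cy' mt; rewrite {y' V0y' Ny' cy' Ru Rt mt}ey.
rewrite (ord_uniformizer hY ut t0) mulr1 (ord_pullback hX hY hf hfin cx vi0).
have [/eqP|hv] := Wv i; first by rewrite (negPf vi0).
have {hv} := hv _ Ufy cx; rewrite /round_down.
have [g hg] := integral_diff cx.
have d1 : Delta (f y) < 1.
  have : round_down Delta (f y) < 1 by rewrite Delta_floor.
  by rewrite /round_down floor_lt_int.
have dY := DeltaY_eff y.
move: (ord (f y) (tnth v i)) => o.
(* For an integer [o], [0 <= o + floor q] means [- o <= q], so the rounding disappears from
   hypothesis and goal. *)
rewrite -[X in 0 <= _ + X -> _]opprK subr_ge0 lerNl floor_ge_int => ho.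
rewrite -[X in 0 <= _ + X]opprK subr_ge0 lerNl floor_ge_int.
have ge : g <= e y - 1.
  suff : g%:~R < (e y)%:~R :> rat by rewrite ltr_int; lia.
  have : (0 : rat) < (e y)%:~R by rewrite ltr0z.
  by rewrite -hg; nra.
have eN : (`|e y - 1|%N : int) = e y - 1 by lia.
rewrite eN.
have geq : (g%:~R : rat) <= (e y)%:~R - 1.
  have : (g%:~R : rat) <= (e y - 1)%:~R by rewrite ler_int.
  by rewrite intrB.
move: ho; rewrite !mulrA -!natrM -expnSr => ho.
rewrite rmorphN rmorphD !rmorphM /= intrB.
rewrite rmorphN /= in ho.
have : (0 : rat) <= ((p ^ i.+1)%N%:~R) by rewrite ler0z.
have eP : (p ^ i.+1)%N%:R = ((p ^ i.+1)%N%:~R : rat) by [].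
rewrite eP in ho *.
move: ((p ^ i.+1)%N%:~R : rat) ho => P ho P0.
have er0 : (0 : rat) < (e y)%:~R by rewrite ltr0z.
move: ((e y)%:~R : rat) (g%:~R : rat) (o%:~R : rat) hg geq er0 ho => E G o' hg geq er0 ho.
have h1 : - (o' * E) <= P * (G + DeltaY y).
  have -> : G + DeltaY y = Delta (f y) * E by lra.
  by rewrite mulrA -mulNr ler_pM2r.
have h2 : P * G <= P * (E - 1) by rewrite ler_wpM2l.
by move: h1; rewrite mulrDr; lra.
Qed.

(** [phi t] has order [e y] at [y], one more than the largest possible pole; this prepares
    [max_ideal_trace]. *)
Lemma descent_max_ideal (U : set X) v y t : open U -> U (f y) -> codim1 (f y) ->
  uniformizer (f y) t -> t != 0 ->
  @witt_sheaf_of _ X p n (fun x => p%:R * Delta x) U v ->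
  max_ideal y (phi t * beta (map_tuple phi v)).
Proof.
move=> oU Ufy cx ut t0 Wv.
have cy := codim1_over hX hY hf hfin cx.
have e0 := ramification_index_gt0 hX hY hf hfin cx.
have [t' ut' t'0] := codim1_uniformizer hY cy.
have := descent_local oU Ufy cx ut' t'0 Wv.
set b := beta _; set s := t' ^+ _ => Rsb.
have s0 : s != 0 by rewrite expf_neq0.
have -> : phi t * b = (s * b) * (phi t / s) by field.
apply: nonunits_mul => //; first exact: stalk_subring.
have pt0 : phi t != 0 by rewrite fmorph_eq0.
apply/(max_ideal_ord hY cy); first by rewrite mulf_neq0 ?invr_eq0.
rewrite ordM ?invr_eq0 // -exprN1 ordXz // ordX // (ord_uniformizer hY ut' t'0).
rewrite -(ramification_indexE hX hY hf hfin cx ut t0); lia.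
Qed.

Lemma descent_generic_splitting d : p \in [pchar k] -> field_degree phi d -> ~~ (p %| d)%N ->
  exists alpha, generic_splitting (X := X) p (n := n) Delta alpha.
Proof.
move=> hp hd hpd.
have hpK : p \in [pchar funfield X] by apply: (rmorph_pchar (scalars X)).
have d0 : (0 < d)%N by case: d hd hpd => //; rewrite dvdn0.
have [Tr [TrD TrZ Tr1 Trp]] := field_degree_trace hd d0 hpK.
have dk0 : d%:R != 0 :> k by rewrite -(dvdn_pcharf hp).
have dK0 : d%:R != 0 :> funfield X by rewrite -(dvdn_pcharf hpK).
have [b1 b2 b3 b4] := hbeta.
have nth_phi (r : n.-tuple (funfield X)) : (map_tuple phi r)`_0 = phi r`_0.
  by rewrite -!(tnth_nth 0 _ (Ordinal n_gt0)) tnth_map.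
exists (fun v => d%:R^-1 * Tr (beta (map_tuple phi v))); split.
- move=> U v hU Wv; have [oU _] := hU.
  apply: subringM; first exact: sections_subring.
    by rewrite -(rmorph_nat (scalars X)) -fmorphV; apply: sections_scalars.
  apply: sections_of_stalks => // x Ux; apply: stalk_hartogs => // x' cx' cl.
  have Ux' : U x' by move/closure1P: cl; apply.
  have [t ut t0] := codim1_uniformizer hX cx'.
  have : max_ideal x' (Tr (phi t * beta (map_tuple phi v))).
    apply: (max_ideal_trace hX hY hf hfin p_gt1 TrD TrZ Trp cx') => y ey.
    by apply: (descent_max_ideal oU); rewrite ?ey.
  (* [t] generates [max_ideal x'], so it cancels from [t * Tr (beta (map_tuple phi v))]. *)
  by rewrite TrZ => /(proj2 ut) [a Ra /eqP]; rewrite mulrC (inj_eq (mulIf t0)) => /eqP ->.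
- by move=> v w; rewrite /witt_add witt_op_rmorph b2 TrD mulrDr.
- move=> r v; rewrite /witt_mul witt_op_rmorph witt_frob_rmorph b3 nth_phi TrZ.
  by rewrite mulrCA.
- move=> v; rewrite witt_frob_rmorph b4 nth_phi -[phi _]mulr1 TrZ Tr1 mulrCA.
  by rewrite mulVf // mulr1.
Qed.

End Descent.

Theorem corollary3p20
  (p : nat) (k : fieldType) (hp : p \in [pchar k]) (hk : F_finite_field p k)
  (X Y : ratspace k) (hX : normal_variety X) (hY : normal_variety Y)
  (f : Y -> X) (phi : {rmorphism funfield X -> funfield Y})
  (hf : surjective_morphism f phi) (hfin : finite_morphism f phi)
  (n : nat) (hn : (1 <= n)%N)
  (Delta : X -> rat) (DeltaY : Y -> rat)
  (hDelta : Qdivisor Delta) (hDeltaY : Qdivisor DeltaY)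
  (Delta_eff : effective Delta) (DeltaY_eff : effective DeltaY)
  (Delta_floor : forall x, round_down Delta x = 0)
  (DeltaY_floor : forall y, round_down DeltaY y = 0)
  (KX : X -> rat) (KY : Y -> rat)
  (hKX : canonical_divisor KX) (hKY : canonical_divisor KY)
  (hlin : lin_equiv (pullback f phi (fun x => KX x + Delta x))
                    (fun y => KY y + DeltaY y))
  (d : nat) (hd : field_degree phi d) (hpd : ~~ (p %| d)%N) :
  quasi_F_split p n DeltaY -> quasi_F_split p n Delta.
Proof.
move=> hYsplit.
have [beta hbeta] := quasi_F_split_generic_splitting hY DeltaY_eff hYsplit.
have p1 : (1 < p)%N by apply/prime_gt1/pcharf_prime/hp.
have hint y : codim1 (f y) -> exists g : int,
    (ramification_index f phi y)%:~R * Delta (f y) - DeltaY y = g%:~R.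
  move=> cx; have cy := codim1_over hX hY hf hfin cx.
  have [psi _ hpsi] := hlin; have := hpsi y cy; rewrite /pullback.
  have [_ [r [dX [_ hdX]]]] := hKX; have [m [-> _ _]] := hdX _ cx.
  have [_ [r' [dY [_ hdY]]]] := hKY; have [m' [-> _ _]] := hdY _ cy.
  set E := ramification_index _ _ _ => h.
  (* The canonical divisors have coefficients [- m] at [f y] and [- m'] at [y]; the former is
     multiplied by [E] under pullback. *)
  exists (ord y psi + E * m - m'); rewrite intrB intrD intrM -h; ring.
have [alpha halpha] := descent_generic_splitting p1 hn hX hY hf hfin Delta_floor
  DeltaY_eff hint hbeta hp hd hpd.
exact: generic_splitting_quasi_F_split halpha.
Qed.
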